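(* If $n\ge 3$, there is an infinite set $\Sigma\subset\mathbb{S}^n$ and a complete conformal metric $g=e^{2f}\,\mathrm{can}$ on $\mathbb{S}^n\setminus\Sigma$ whose sectional curvatures are bounded from below and such that $$\int_{\mathbb{S}^n\setminus\Sigma}\sigma_-(g)^{\frac n2}\,\mathrm{dv}_g<\infty .$$
   Context: $\mathrm{can}$ is the standard round metric on the unit sphere $\mathbb{S}^n$; the set $\Sigma$ is closed, so that $\mathbb{S}^n\setminus\Sigma$ is an open submanifold, and $f$ is a smooth function on $\mathbb{S}^n\setminus\Sigma$. For a Riemannian metric $g$ on a manifold $M$, the function $\sigma_-(g)\colon M\to[0,\infty)$ is defined by: $\sigma_-(g)(x)=0$ if all sectional curvatures of $g$ at $x$ are nonnegative, and otherwise $-\sigma_-(g)(x)$ is the lowest sectional curvature of $g$ at $x$. $\mathrm{dv}_g$ is the Riemannian volume measure. *)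

(* Defs.v *)
From HB Require Import structures.
From mathcomp Require Import all_boot all_order all_algebra.
From mathcomp Require Import all_classical all_reals all_analysis.

Set Implicit Arguments.
Unset Strict Implicit.
Unset Printing Implicit Defensive.

Import Order.TTheory GRing.Theory Num.Theory.
Import numFieldNormedType.Exports.

Local Open Scope classical_set_scope.
Local Open Scope ring_scope.

(* The library norm on row vectors is the sup norm, so the Euclidean structure
   is given by this inner product; the topology is the same. *)
Definition dotv (R : realType) (m : nat) (x y : 'rV[R]_m) : R :=
  \sum_(i < m) x 0 i * y 0 i.

Definition pd (R : realType) (n : nat) (V : normedModType R)
    (i : 'I_n) (F : 'rV[R]_n -> V) (u : 'rV[R]_n) : V :=
  'D_(delta_mx 0 i) F u.

(* [U] is meant to be open. *)
Fixpoint Ck_on (R : realType) (n : nat) (k : nat) (U : set 'rV[R]_n)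
    (F : 'rV[R]_n -> R) : Prop :=
  (forall u, U u -> {for u, continuous F}) /\
  match k with
  | 0 => True
  | k'.+1 => forall i : 'I_n,
      (forall u, U u -> derivable F u (delta_mx 0 i)) /\ Ck_on k' U (pd i F)
  end.

Definition smooth_on (R : realType) (n : nat) (U : set 'rV[R]_n)
    (F : 'rV[R]_n -> R) : Prop :=
  forall k, Ck_on k U F.

(* Riemannian geometry in coordinates: G u is the Gram matrix (g_ij)(u). *)
Section Coordinates.
Context (R : realType) (n : nat) (G : 'rV[R]_n -> 'M[R]_n).

(* Gamma^k_ij = 1/2 g^{kl} (d_i g_jl + d_j g_il - d_l g_ij) *)
Definition christoffel (k i j : 'I_n) (u : 'rV[R]_n) : R :=
  2^-1 * \sum_(l < n) invmx (G u) k l *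
    (pd i (fun w => G w j l) u + pd j (fun w => G w i l) u
     - pd l (fun w => G w i j) u).

(* R(d_i, d_j) d_k = R^l_{kij} d_l, where
   R(X, Y) Z = nabla_X nabla_Y Z - nabla_Y nabla_X Z - nabla_[X, Y] Z *)
Definition riemann (l k i j : 'I_n) (u : 'rV[R]_n) : R :=
  pd i (christoffel l j k) u - pd j (christoffel l i k) u
  + \sum_(m < n) (christoffel l i m u * christoffel m j k u
                  - christoffel l j m u * christoffel m i k u).

Definition inner_at (u v w : 'rV[R]_n) : R := (v *m G u *m w^T) 0 0.

Definition curvature_op (u v w z : 'rV[R]_n) : 'rV[R]_n :=
  \row_l \sum_(i < n) \sum_(j < n) \sum_(k < n)
    riemann l k i j u * v 0 i * w 0 j * z 0 k.

(* sectional curvature of the plane spanned by v and w *)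
Definition sect_curv (u v w : 'rV[R]_n) : R :=
  inner_at u (curvature_op u v w w) v /
  (inner_at u v v * inner_at u w w - inner_at u v w ^+ 2).

End Coordinates.

Section LebesgueMeasureRn.
Context {R : realType}.
Local Notation RB := (measurableTypeR R).

Definition cons_pair (n : nat) (p : RB * n.-tuple RB) : n.+1.-tuple RB :=
  [tuple of p.1 :: p.2].

Definition uncons_pair (n : nat) (t : n.+1.-tuple RB) : RB * n.-tuple RB :=
  (thead t, [tuple of behead t]).

Lemma uncons_pairK n : cancel (@cons_pair n) (@uncons_pair n).
Proof. by case=> x t; congr (_, _); apply: val_inj. Qed.

Lemma measurable_cons_pair n : measurable_fun setT (@cons_pair n).
Proof. exact: measurable_cons. Qed.

Lemma measurable_uncons_pair n : measurable_fun setT (@uncons_pair n).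
Proof.
apply/measurable_fun_pairP; split; first exact: (measurable_tnth ord0).
exact: measurable_behead.
Qed.


Section Step.
Context (n : nat)
  (mu : {sigma_finite_measure set (n.-tuple RB) -> \bar R}).

Definition lebesgue_step : set (n.+1.-tuple RB) -> \bar R :=
  pushforward (lebesgue_measure \x mu)%E (@cons_pair n).

Let step0 : lebesgue_step set0 = 0%E.
Proof. by rewrite /lebesgue_step /pushforward preimage_set0 measure0. Qed.

Let mpre (A : set (n.+1.-tuple RB)) :
  measurable A -> measurable (@cons_pair n @^-1` A).
Proof. by move=> mA; rewrite -[X in measurable X]setTI; exact: measurable_cons_pair. Qed.

Let step_ge0 A : (0 <= lebesgue_step A)%E.
Proof. by rewrite /lebesgue_step /pushforward; exact: measure_ge0. Qed.

Let step_sigma_additive : semi_sigma_additive lebesgue_step.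
Proof.
move=> F mF tF mUF; rewrite /lebesgue_step /pushforward preimage_bigcup.
apply: measure_semi_sigma_additive.
- by move=> k; exact: mpre.
- apply/trivIsetP => /= i j _ _ ij; rewrite -preimage_setI.
  by move/trivIsetP : tF => /(_ _ _ _ _ ij) ->//; rewrite preimage_set0.
- by rewrite -preimage_bigcup; exact: mpre.
Qed.

HB.instance Definition _ := isMeasure.Build _ _ _ lebesgue_step
  step0 step_ge0 step_sigma_additive.

Let step_sigma_finite : sigma_finite setT lebesgue_step.
Proof.
have /sigma_finiteP[F [TF ndF Foo]] := sigma_finiteT (@lebesgue_measure R).
have /sigma_finiteP[G [TG ndG Goo]] := sigma_finiteT mu.
exists (fun k => @uncons_pair n @^-1` (F k `*` G k)).
  apply/esym; rewrite -subTset => t _.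
  have [i _ Fi] : (\bigcup_k F k) (thead t) by rewrite -TF.
  have [j _ Gj] : (\bigcup_k G k) [tuple of behead t] by rewrite -TG.
  exists (maxn i j) => //; split.
  - by move: Fi; exact/subsetPset/ndF/leq_maxl.
  - by move: Gj; exact/subsetPset/ndG/leq_maxr.
move=> k; have [mFk Fk] := Foo k; have [mGk Gk] := Goo k.
have mFG : measurable (F k `*` G k) by exact: measurableX.
split.
  by rewrite -[X in measurable X]setTI; exact: measurable_uncons_pair.
rewrite /lebesgue_step /pushforward -comp_preimage.
rewrite (_ : _ \o _ = id); last by apply/funext => x /=; rewrite uncons_pairK.
by rewrite preimage_id product_measure1E// lte_mul_pinfty// ge0_fin_numE.

Qed.

HB.instance Definition _ := Measure_isSigmaFinite.Build _ _ _ lebesgue_step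
  step_sigma_finite.

End Step.

(* n-dimensional Lebesgue measure, transported from the iterated product
   R * (R * (...)) to n-tuples; R^0 carries the unit point mass. *)
Fixpoint lebesgue_measure_n (n : nat) :
    {sigma_finite_measure set (n.-tuple RB) -> \bar R} :=
  match n with
  | 0 => \d_([tuple] : 0.-tuple RB)
  | n'.+1 => lebesgue_step (lebesgue_measure_n n')
  end.

End LebesgueMeasureRn.

Section Sphere.
Context {R : realType} {n : nat}.
Implicit Types (x y v w : 'rV[R]_n.+1) (u : 'rV[R]_n).
Implicit Types (M : set 'rV[R]_n.+1).

Definition sphere : set 'rV[R]_n.+1 := [set x | dotv x x = 1].

Definition pole (s : bool) : 'rV[R]_n.+1 :=
  (row_mx (const_mx ((-1) ^+ s)) 0 : 'rV[R]_(1 + n)).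

(* Inverse stereographic projection from pole s: a smooth parametrization of
   the sphere minus pole s by R^n. The two of them form an atlas. *)
Definition stereo (s : bool) (u : 'rV[R]_n) : 'rV[R]_n.+1 :=
  (1 + dotv u u)^-1 *:
    (row_mx (const_mx ((-1) ^+ s * (dotv u u - 1))) (2 *: u) : 'rV[R]_(1 + n)).

(* the chart used around x: its pole differs from x *)
Definition chart_at (x : 'rV[R]_n.+1) : bool := x == pole false.

(* f : M -> R is smooth on the open subset M of the sphere; the values of f
   outside M are irrelevant. *)
Definition smooth_fun (M : set 'rV[R]_n.+1) (f : 'rV[R]_n.+1 -> R) : Prop :=
  forall x, M x -> exists s u,
    stereo s u = x /\ smooth_on (stereo s @^-1` M) (f \o stereo s).

(* A metric tensor on an open subset of the sphere: [g x v w] is used only for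
   v, w tangent to the sphere at x. *)
Definition metric_tensor := 'rV[R]_n.+1 -> 'rV[R]_n.+1 -> 'rV[R]_n.+1 -> R.
Implicit Types g : metric_tensor.

(* the round metric, induced by the Euclidean inner product *)
Definition can : metric_tensor := fun _ v w => dotv v w.

Definition conformal (f : 'rV[R]_n.+1 -> R) : metric_tensor :=
  fun x v w => expR (2 * f x) * can x v w.

Definition gram g (s : bool) (u : 'rV[R]_n) : 'M[R]_n :=
  \matrix_(i < n, j < n) g (stereo s u) (pd i (stereo s) u) (pd j (stereo s) u).

(* Sectional curvatures at x of all tangent planes, computed in the chart
   around x (they do not depend on the chart). *)
Definition sectional_curvatures g (x : 'rV[R]_n.+1) : set R :=
  [set K | exists u v w : 'rV[R]_n,
    [/\ stereo (chart_at x) u = x,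
        row_free (col_mx v w) &
        K = sect_curv (gram g (chart_at x)) u v w]].

Definition sec_bounded_below g M : Prop :=
  exists k : R, forall x, M x ->
    forall K, sectional_curvatures g x K -> k <= K.

Definition sigma_minus g (x : 'rV[R]_n.+1) : R :=
  if `[< forall K, sectional_curvatures g x K -> 0 <= K >] then 0
  else - inf (sectional_curvatures g x).

(* C^1 on a closed interval is expressed by a C^1 extension to the line. *)
Definition piecewise_C1 (c : R -> 'rV[R]_n.+1) : Prop :=
  exists (k : nat) (t : nat -> R),
    [/\ t 0%N = 0, t k = 1 &
      forall i, (i < k)%N -> t i < t i.+1 /\
        exists b : R -> 'rV[R]_n.+1,
          [/\ forall r, derivable b r 1, continuous (derive1 b) &
              {in `[t i, t i.+1], c =1 b}]].

Definition curve_length g (c : R -> 'rV[R]_n.+1) : \bar R :=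
  (\int[@lebesgue_measure R]_(r in `[0%R, 1%R])
     (Num.sqrt (g (c r) (derive1 c r) (derive1 c r)))%:E)%E.

(* +oo when x and y lie in different components of M *)
Definition riem_dist g M x y : \bar R :=
  ereal_inf [set L | exists c : R -> 'rV[R]_n.+1,
    [/\ piecewise_C1 c, c 0 = x, c 1 = y,
        forall r, r \in `[0, 1] -> M (c r) & L = curve_length g c]].

Definition complete_metric g M : Prop :=
  forall a : nat -> 'rV[R]_n.+1,
    (forall k, M (a k)) ->
    (forall e : R, 0 < e -> exists N : nat, forall p q,
      (N <= p)%N -> (N <= q)%N -> (riem_dist g M (a p) (a q) < e%:E)%E) ->
    exists2 l, M l & riem_dist g M (a k) l @[k --> \oo] --> 0%E.

Definition row_of_tuple (t : n.-tuple R) : 'rV[R]_n := \row_i tnth t i.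

(* Integral of h over M against the Riemannian measure dv_g, whose density in a
   chart is sqrt (det g_ij); one stereographic chart suffices, since it misses a
   single point, which is a null set. *)
Definition riem_integral g M (h : 'rV[R]_n.+1 -> R) : \bar R :=
  (\int[@lebesgue_measure_n R n]_(t in
       [set t | M (stereo false (row_of_tuple t))])
     (h (stereo false (row_of_tuple t)) *
      Num.sqrt (\det (gram g false (row_of_tuple t))))%:E)%E.

End Sphere.

Arguments sphere : clear implicits.

(* Main.v *)
(* Work in one stereographic chart, so that the metric becomes [e^(2F)] times the
   Euclidean metric of [R^n], with singular points [p_k] going to infinity (the pole).
   Near [p_k] the factor [F] is radial and supported in a ball of radius [e^L],
   [L = L_k], these balls being disjoint.  In the coordinate [s = ln |u - p_k|] the
   metric is [e^(2v) (ds^2 + dtheta^2)] with [v = s + F], and its sectional curvatures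
   lie between [- v'' e^(-2v)] and [(1 - v'^2) e^(-2v)].  We let [v'] go from [1]
   (flat space) to [0] (a cylinder) as [s] goes down from [L] to [-oo]:
   [F = L (1 + x) e^(-1/x)] with [x = 1 - s/L].  Then [|v'| <= 1] and [v >= 0], and [v'']
   is positive only for [0 < x < 1], where it is at most [24/L].  Hence the metric is
   complete with curvature at least [- 24/L], and the integral of
   [sigma_-^(n/2)] over the [k]-th ball is of order [L * L^(-n/2)].  Since [n >= 3],
   this is summable in [k] for exponentially growing [L_k]. *)

From mathcomp Require Import all_boot all_order all_algebra.
From mathcomp Require Import all_classical all_reals all_analysis.
From mathcomp Require Import measurable_realfun.
From mathcomp Require Import ring lra.
Require Import Defs.
Set Implicit Arguments.
Unset Strict Implicit.
Unset Printing Implicit Defensive.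
Import Order.TTheory GRing.Theory Num.Theory.
Import numFieldNormedType.Exports.

Local Open Scope classical_set_scope.
Local Open Scope ring_scope.

(** * Calculus of C^k functions *)

(** The [sigma_-^(n/2)] integral hardly sees the conformal factor: the [e^(-nF)] coming from the
    curvature cancels the [e^(nF)] of the volume. What remains on a neck is a power of [1/L] times
    the integral of [rho^(-n)] over a shell, which is proportional to [L].

    The factor [1 + x] of the profile makes the negative curvature stop at a positive distance from
    [p_k]. With [y = 1/x], the second derivative of [x e^(-y)] is [y^3 e^(-y) > 0], so [v''] would
    be positive along the whole infinite end. For [(1 + x) e^(-y)] it is [(y^4 - y^3) e^(-y)], which
    changes sign at [x = 1]. The price is that [v'] overshoots: it falls to [1 - 3/e < 0] at [x = 1]
    and returns to [0] from below, which is harmless while [|v'| <= 1].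

    Completeness is shown without geodesics, through functions that are 1-Lipschitz for the metric:
    the chart coordinates, which keep Cauchy sequences away from the pole, and the logarithms of the
    distances to the [p_k], which keep them away from these points. *)

Section Derivatives.
Context {R : realType}.

(** Restricting to a line reduces directional derivatives to one variable, so the chain rule on the
    line serves both functions on the chart and curves. *)
Lemma is_derive_line (V W : normedModType R) (F : V -> W) u v d :
  is_derive u v F d <-> is_derive (0 : R) 1 (fun h : R => F (h *: v + u)) d.
Proof.
have E : 'D_v F u = 'D_1 (fun h : R => F (h *: v + u)) (0 : R).
  rewrite /derive; set g1 := fun h => h^-1 *: _; set g2 := fun h => h^-1 *: _.
  suff -> : g1 = g2 by []; apply/funext => h; rewrite /g1 /g2 /=.
  by rewrite addr0 scale0r add0r [_%:A]mulr1.
split=> -[dF dE]; apply: DeriveDef.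
- exact: (derivable1P F u v).1.
- by rewrite -E.
- exact: (derivable1P F u v).2.
- by rewrite E.
Qed.

Lemma is_derive_compR (V : normedModType R) (phi : R -> R) (F : V -> R) u v d d' :
  is_derive u v F d -> is_derive (F u) 1 phi d' ->
  is_derive u v (phi \o F) (d' * d).
Proof.
move=> /is_derive_line dF dphi; apply/is_derive_line.
apply: (@is_derive1_comp _ phi (fun h : R => F (h *: v + u)) 0 d' d) => //.
by rewrite scale0r add0r.
Qed.

Lemma is_derive_addf (V : normedModType R) (f g : V -> R) u v (d e : R) :
  is_derive u v f d -> is_derive u v g e -> is_derive u v (fun w => f w + g w) (d + e).
Proof. by move=> df dg; exact: (@is_deriveD _ _ _ f g). Qed.

Lemma is_derive_mulf (V : normedModType R) (f g : V -> R) u v d e :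
  is_derive u v f d -> is_derive u v g e ->
  is_derive u v (fun w => f w * g w) (f u * e + g u * d).
Proof. by move=> df dg; exact: (@is_deriveM _ _ f g). Qed.

Lemma is_derive_cmul (V : normedModType R) (f : V -> R) (c : R) u v d :
  is_derive u v f d -> is_derive u v (fun w => c * f w) (c * d).
Proof. by move=> df; exact: (@is_deriveZ _ _ _ f c). Qed.

Lemma is_derive_sumf (V : normedModType R) m (f : 'I_m -> V -> R) u v (d : 'I_m -> R) :
  (forall i, is_derive u v (f i) (d i)) ->
  is_derive u v (fun w => \sum_(i < m) f i w) (\sum_(i < m) d i).
Proof.
move=> df; rewrite (_ : (fun w => _) = \sum_(i < m) f i); first exact: is_derive_sum.
by apply/funext => w; rewrite fct_sumE.
Qed.

Lemma is_derive_coord m n (i : 'I_m) (j : 'I_n) (M v : 'M[R]_(m, n)) :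
  is_derive M v (fun N => N i j) (v i j).
Proof.
apply/is_derive_line.
rewrite (_ : (fun _ => _) = fun h : R => h * v i j + M i j); last first.
  by apply/funext => h; rewrite !mxE.
by apply: is_derive_eq; rewrite scaler0 add0r addr0 [_%:A]mulr1.
Qed.

Lemma is_derive_rowP (V : normedModType R) n (F : V -> 'rV[R]_n) u v
    (d : 'rV[R]_n) :
  (forall j, is_derive u v (fun w => F w 0 j) (d 0 j)) <-> is_derive u v F d.
Proof.
split=> [h|[dF <-] j].
- have dF : derivable F u v.
    by apply/derivable_mxP => i j; rewrite (ord1 i); case: (h j).
  split=> //; rewrite derive_mx //; apply/rowP => j; rewrite mxE.
  by case: (h j).
- split; first by move/derivable_mxP: dF; apply.
  by rewrite derive_mx // mxE.
Qed.

End Derivatives.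

Section CkCalculus.
Context {R : realType} {n : nat}.
Implicit Types (U W : set 'rV[R]_n) (F G : 'rV[R]_n -> R) (k : nat).

Lemma Ck_onW k U F : Ck_on k.+1 U F -> Ck_on k U F.
Proof.
elim: k F => [|k IH] F [cF dF]; first by split.
split=> // i; have [d1 d2] := dF i; split=> //; exact: IH.
Qed.

Lemma Ck_on_is_derive k U F i u : Ck_on k.+1 U F -> U u ->
  is_derive u (delta_mx 0 i) F (pd i F u).
Proof. by move=> [_ /(_ i) [d _]] Uu; split=> //; exact: d. Qed.

Lemma near_eq_continuous (T : topologicalType) (F G : T -> R) u :
  (\forall w \near u, F w = G w) -> {for u, continuous F} -> {for u, continuous G}.
Proof.
move=> FG cF; suff : G w @[w --> u] --> G u by [].
rewrite -(nbhs_singleton FG); exact: cvg_trans (near_eq_cvg FG) cF.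
Qed.

Lemma Ck_on_eq k U F G : open U -> {in U, F =1 G} -> Ck_on k U F -> Ck_on k U G.
Proof.
move=> oU; have nFG (F' G' : 'rV[R]_n -> R) u : {in U, F' =1 G'} -> U u ->
    \forall w \near u, F' w = G' w.
  move=> FG Uu; apply: filterS (open_nbhs_nbhs (conj oU Uu)) => w Uw.
  by apply: FG; rewrite inE.
elim: k F G => [|k IH] F G FG [cF dF].
  split=> // u Uu; exact: near_eq_continuous (nFG _ _ _ FG Uu) (cF u Uu).
split; first by move=> u Uu; exact: near_eq_continuous (nFG _ _ _ FG Uu) (cF u Uu).
move=> i; have [d1 d2] := dF i; split.
  by move=> u Uu; apply: near_eq_derivable (d1 u Uu); exact: nFG.
apply: IH d2 => u; rewrite inE => Uu; apply: near_eq_derive; exact: nFG.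
Qed.

(** Needed because [potential] is given by a single [pot k] only near each point. *)
Lemma Ck_on_local k U F :
  (forall u, U u -> exists2 W, open_nbhs u W & Ck_on k W F) -> Ck_on k U F.
Proof.
elim: k F => [|k IH] F h.
  by split=> // u /h [W [_ Wu] [cF _]]; exact: cF.
split; first by move=> u /h [W [_ Wu] [cF _]]; exact: cF.
move=> i; split.
  by move=> u /h [W [_ Wu] [_ /(_ i) [d _]]]; exact: d.
by apply: IH => u /h [W oW [_ /(_ i) [_ d]]]; exists W.
Qed.

Lemma Ck_on_step k U F (dF : 'I_n -> 'rV[R]_n -> R) : open U ->
  (forall u, U u -> {for u, continuous F}) ->
  (forall i u, U u -> is_derive u (delta_mx 0 i) F (dF i u)) ->
  (forall i, Ck_on k U (dF i)) -> Ck_on k.+1 U F.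
Proof.
move=> oU cF hd hC; split=> // i; split; first by move=> u /(hd i) [].
apply: Ck_on_eq (hC i) => // u; rewrite inE => /(hd i) [_ <-] //.
Qed.

Lemma Ck_on_continuous k U F u : Ck_on k U F -> U u -> {for u, continuous F}.
Proof. by case: k => [|k] [cF _]; exact: cF. Qed.

Lemma Ck_on_cst k U (c : R) : open U -> Ck_on k U (cst c).
Proof.
move=> oU; elim: k c => [|k IH] c; first by split=> // u _; exact: cst_continuous.
apply: (@Ck_on_step _ _ _ (fun _ => cst 0)) => //.
by move=> u _; exact: cst_continuous.
Qed.

Lemma Ck_on_coord k U (j : 'I_n) : open U -> Ck_on k U (fun w => w 0 j).
Proof.
move=> oU; case: k => [|k].
  by split=> // u _; exact: coord_continuous.
apply: (@Ck_on_step _ _ _ (fun i => cst (delta_mx (0 : 'I_1) i 0 j))) => //.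
- by move=> u _; exact: coord_continuous.
- by move=> i u _; exact: is_derive_coord.
- by move=> i; exact: Ck_on_cst.
Qed.

Lemma Ck_onD k U F G : open U -> Ck_on k U F -> Ck_on k U G ->
  Ck_on k U (fun w => F w + G w).
Proof.
move=> oU; elim: k F G => [|k IH] F G hF hG.
  by split=> // u Uu; exact: (continuousD (hF.1 u Uu) (hG.1 u Uu)).
apply: (@Ck_on_step _ _ _ (fun i w => pd i F w + pd i G w)) => //.
- by move=> u Uu; exact: (continuousD (hF.1 u Uu) (hG.1 u Uu)).
- by move=> i u Uu; exact: (is_derive_addf (Ck_on_is_derive i hF Uu) (Ck_on_is_derive i hG Uu)).
- by move=> i; apply: IH; [exact: (hF.2 i).2|exact: (hG.2 i).2].
Qed.

Lemma Ck_onM k U F G : open U -> Ck_on k U F -> Ck_on k U G ->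
  Ck_on k U (fun w => F w * G w).
Proof.
move=> oU; elim: k F G => [|k IH] F G hF hG.
  by split=> // u Uu; exact: (continuousM (hF.1 u Uu) (hG.1 u Uu)).
apply: (@Ck_on_step _ _ _ (fun i w => F w * pd i G w + G w * pd i F w)) => //.
- by move=> u Uu; exact: (continuousM (hF.1 u Uu) (hG.1 u Uu)).
- by move=> i u Uu; exact: (is_derive_mulf (Ck_on_is_derive i hF Uu) (Ck_on_is_derive i hG Uu)).
- move=> i; apply: Ck_onD => //; apply: IH => //.
  + exact: Ck_onW.
  + exact: (hG.2 i).2.
  + exact: Ck_onW.
  + exact: (hF.2 i).2.
Qed.

Lemma Ck_on_sum k U m (F : 'I_m -> 'rV[R]_n -> R) : open U ->
  (forall i, Ck_on k U (F i)) -> Ck_on k U (fun w => \sum_(i < m) F i w).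
Proof.
move=> oU; elim: m F => [|m IH] F hF.
  by under eq_fun do rewrite big_ord0; exact: Ck_on_cst.
under eq_fun do rewrite big_ord_recr /=.
by apply: Ck_onD => //; apply: IH.
Qed.

Lemma Ck_on_sqnorm k U (p : 'rV[R]_n) : open U ->
  Ck_on k U (fun w => dotv (w - p) (w - p)).
Proof.
move=> oU; apply: Ck_on_sum => // i.
have c : Ck_on k U (fun w => (w - p) 0 i).
  under eq_fun do rewrite mxE.
  by apply: Ck_onD => //; [exact: Ck_on_coord|exact: Ck_on_cst].
exact: Ck_onM.
Qed.

(* Iterated derivatives are given existentially, so that the derivative of a
   function with a closed form need not be identified with [derive1]. *)
Fixpoint Ck1 k (V : set R) (phi : R -> R) : Prop :=
  (forall t, V t -> {for t, continuous phi}) /\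
  match k with
  | 0 => True
  | k'.+1 => exists2 psi, (forall t, V t -> is_derive t 1 phi (psi t)) & Ck1 k' V psi
  end.

Lemma Ck_on_comp k U (V : set R) phi F : open U -> Ck1 k V phi -> Ck_on k U F ->
  (forall u, U u -> V (F u)) -> Ck_on k U (fun w => phi (F w)).
Proof.
move=> oU + + UV; elim: k phi F UV => [|k IH] phi F UV hphi hF.
  by split=> // u Uu; exact: (continuous_comp (hF.1 u Uu) (hphi.1 _ (UV u Uu))).
have [cphi [psi dpsi hpsi]] := hphi.
apply: (@Ck_on_step _ _ _ (fun i w => psi (F w) * pd i F w)) => //.
- by move=> u Uu; exact: (continuous_comp (hF.1 u Uu) (cphi _ (UV u Uu))).
- by move=> i u Uu; exact: (is_derive_compR (Ck_on_is_derive i hF Uu) (dpsi _ (UV u Uu))).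
- move=> i; apply: Ck_onM => //; last exact: (hF.2 i).2.
  by apply: IH => //; exact: Ck_onW.
Qed.

End CkCalculus.

(** * The radial profile *)

Section FlatFunctions.
Context {R : realType}.

Lemma is_derive_invr (x : R) : x != 0 -> is_derive x 1 (fun t : R => t^-1) (- x^-1 ^+ 2).
Proof.
move=> x0; apply: is_derive_eq (is_deriveV x0 (is_derive_id _ _)) _.
by rewrite exprVn -[_ *: _]/(_ * _) mulr1.
Qed.

(** This two-parameter family is closed under differentiation, which is what carries the induction
    on [k]. *)
Lemma Ck1_invrX k (c : R) m : Ck1 k [set t | 0 < t] (fun t => c * t^-1 ^+ m).
Proof.
have d (c' : R) m' (t : R) : 0 < t ->
    is_derive t 1 (fun t => c' * t^-1 ^+ m') ((- m'%:R * c') * t^-1 ^+ m'.+1).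
  move=> t0; have t0' : t != 0 by rewrite gt_eqF.
  rewrite (_ : (fun t => c' * _) = fun t => c' * ((fun t : R => t^-1) ^+ m') t); last first.
    by apply/funext => z; rewrite exprfctE.
  apply: is_derive_eq (is_derive_cmul c' (is_deriveX m' (is_derive_invr t0'))) _.
  case: m' => [|m']; first by rewrite mul0r scale0r mulr0 oppr0 !mul0r.
  by rewrite -[_ *: _]/(_ * _) /= !exprS; ring.
have cc (c' : R) m' (t : R) : 0 < t -> {for t, continuous (fun t : R => c' * t^-1 ^+ m')}.
  by move=> t0; have [dt _] := d c' m' t t0;
    apply/differentiable_continuous/derivable1_diffP.
elim: k c m => [|k IH] c m; split=> //; try exact: cc.
by exists (fun t => (- m%:R * c) * t^-1 ^+ m.+1) => //; exact: d.
Qed.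

Lemma Ck1_ln k : Ck1 k [set t : R | 0 < t] (@ln R).
Proof.
case: k => [|k]; split=> //; try exact: continuous_ln.
exists (fun t => 1 * t^-1 ^+ 1); last exact: Ck1_invrX.
by move=> t t0; rewrite mul1r expr1; exact: is_derive1_ln.
Qed.

Implicit Types (p : {poly R}) (x y : R).

Definition flat p x := if 0 < x then p.[x^-1] * expR (- x^-1) else 0.

Lemma flat_le0 p x : x <= 0 -> flat p x = 0.
Proof. by rewrite /flat ltNge => ->. Qed.

Lemma flat_gt0 p x : 0 < x -> flat p x = p.[x^-1] * expR (- x^-1).
Proof. by rewrite /flat => ->. Qed.

Lemma flat1_gt0 x : 0 < x -> flat 1 x = expR (- x^-1).
Proof. by move=> x0; rewrite flat_gt0 // -polyC1 hornerC mul1r. Qed.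

Lemma horner_bound p : exists2 C : R, 0 <= C &
  forall y, 1 <= y -> `|p.[y]| <= C * y ^+ size p.
Proof.
exists (\sum_(i < size p) `|p`_i|); first exact: sumr_ge0.
move=> y y1; rewrite horner_coef mulr_suml.
apply: le_trans (ler_norm_sum _ _ _) _; apply: ler_sum => i _.
rewrite normrM ler_wpM2l // normrX ger0_norm ?(le_trans ler01) //.
by apply: ler_weXn2l => //; exact: ltnW.
Qed.

(** The exponential beats every power of [x^-1]. A quadratic bound suffices to make the difference
    quotient at the gluing point [0] tend to [0]. *)
Lemma flat_bound p : exists2 C : R, 0 <= C &
  forall x, x <= 1 -> `|flat p x| <= C * x ^+ 2.
Proof.
have [C C0 hC] := horner_bound p.
exists (C * ((size p).+2)`!%:R); first by rewrite mulr_ge0.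
move=> x x1; have [x0|x0] := lerP x 0.
  by rewrite flat_le0 // normr0 mulr_ge0 ?sqr_ge0 // mulr_ge0.
rewrite flat_gt0 //; set y := x^-1.
have y1 : 1 <= y by rewrite /y invf_ge1.
have y0 : 0 < y by apply: lt_le_trans y1.
have -> : x = y^-1 by rewrite invrK.
rewrite normrM (ger0_norm (expR_ge0 _)) expRN.
(* At index [m] this inequality involves the power [m.+1]. The exponent [(size p).+2] exceeds the
   growth of [p] by two, and these two powers of [y] become [x ^+ 2]. *)
have := @expR_ge1Dxn R y (size p).+1 (ltW y0).
set f := (_`!%:R : R); have f0 : 0 < f by rewrite ltr0n fact_gt0.
move=> he; rewrite ler_pdivrMr ?expR_gt0 //.
apply: le_trans (hC _ y1) _; rewrite -!mulrA ler_wpM2l //.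
have {}he : y ^+ (size p).+2 <= f * expR y.
  rewrite mulrC -ler_pdivrMr //; apply: le_trans he; rewrite lerDr //.
have -> : y ^+ size p = y^-1 ^+ 2 * y ^+ (size p).+2.
  have -> : y ^+ (size p).+2 = y ^+ 2 * y ^+ size p by rewrite -exprD add2n.
  by rewrite mulrA -exprMn mulVf ?expr1n ?mul1r // gt_eqF.
have -> : f * (y^-1 * (y^-1 * expR y)) = y^-1 ^+ 2 * (f * expR y) by rewrite expr2; ring.
by rewrite ler_wpM2l // exprn_ge0 // invr_ge0 ltW.
Qed.

Lemma is_derive_flat p x : is_derive x 1 (flat p) (flat ('X^2 * (p - p^`())) x).
Proof.
have [x0|x0|->] := ltgtP x 0.
- rewrite flat_le0 ?ltW //.
  apply: (@near_eq_is_derive _ _ _ (cst 0)).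
  by near=> t; rewrite flat_le0 //; near: t; exact: lt_le_nbhsl.
- apply: (@near_eq_is_derive _ _ _ (fun t : R => p.[t^-1] * expR (- t^-1))).
    by near=> t; rewrite flat_gt0 //; near: t; exact: lt_nbhsr.
  have dV : is_derive x 1 (fun t : R => t^-1) (- x^-1 ^+ 2).
    by apply: is_derive_invr; rewrite gt_eqF.
  have dp : is_derive x 1 (fun t : R => p.[t^-1]) (p^`().[x^-1] * (- x^-1 ^+ 2)).
    exact: (is_derive_compR dV (is_derive_poly p x^-1)).
  have de : is_derive x 1 (fun t : R => expR (- t^-1)) (expR (- x^-1) * x^-1 ^+ 2).
    have dN : is_derive x 1 (fun t : R => - t^-1) (x^-1 ^+ 2).
      by rewrite -[X in is_derive _ _ _ X]opprK; exact: is_deriveN.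
    exact: (is_derive_compR dN (is_derive_expR _)).
  apply: is_derive_eq (is_derive_mulf dp de) _.
  rewrite flat_gt0 // hornerM hornerXn hornerD hornerN; ring.
- rewrite flat_le0 //.
  have [C C0 hC] := flat_bound p.
  have lim0 : h^-1 *: (flat p (h *: 1 + 0) - flat p 0) @[h --> (0 : R)^'] --> (0 : R).
    apply/cvgrPdist_le => /= e e0; near=> h.
    rewrite sub0r normrN addr0 (flat_le0 _ (lexx 0)) subr0 [h%:A]mulr1.
    rewrite -[_ *: _]/(_ * _) normrM.
    have h1 : h <= 1 by apply: le_trans (ler_norm h) _; near: h; exact: dnbhs0_le.
    have hn0 : h != 0 by near: h; exact: nbhs_dnbhs_neq.
    rewrite normrV ?unitfE // mulrC ler_pdivrMr ?normr_gt0 //.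
    apply: le_trans (hC _ h1) _; rewrite -real_normK ?num_real // expr2 mulrA.
    rewrite ler_wpM2r //.
    have hs : `|h| <= e / (C + 1) by near: h; apply: dnbhs0_le; rewrite divr_gt0 // ltr_wpDl.
    have C1 : 0 < C + 1 by rewrite ltr_wpDl.
    rewrite -(ler_pM2l C1) in hs; rewrite mulrCA divff ?gt_eqF // mulr1 in hs.
    apply: le_trans hs; rewrite ler_wpM2r //; lra.
  by apply: DeriveDef; [apply/cvg_ex; exists 0 | apply/cvg_lim].
Unshelve. all: by end_near. Qed.

Lemma Ck1_flat k p : Ck1 k setT (flat p).
Proof.
elim: k p => [|k IH] p; split=> //.
- by move=> t _; have [d _] := is_derive_flat p t;
    apply/differentiable_continuous/derivable1_diffP.
- by move=> t _; have [d _] := is_derive_flat p t;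
    apply/differentiable_continuous/derivable1_diffP.
- by exists (flat ('X^2 * (p - p^`()))) => // t _; exact: is_derive_flat.
Qed.

End FlatFunctions.

(** * The profile, its first two derivatives and their bounds *)

Section Profile.
Context {R : realType}.
Implicit Type x : R.

Definition profile x := (1 + x) * flat 1 x.
(** In terms of [v = s + F] and [x = 1 - s/L], one has [v' = 1 - dprofile x] and
    [v'' = ddprofile x / L]. *)
Definition dprofile x : R := flat ('X^2 + 'X + 1) x.
Definition ddprofile x : R := flat ('X^4 - 'X^3) x.

Lemma profile_le0 x : x <= 0 -> profile x = 0.
Proof. by move=> x0; rewrite /profile flat_le0 // mulr0. Qed.

Lemma is_derive_profile x : is_derive x 1 profile (dprofile x).
Proof.
have d1 : is_derive x 1 (fun t : R => 1 + t) 1.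
  by apply: is_derive_eq (is_derive_addf (is_derive_cst _ _ _) (is_derive_id _ _)) _;
    rewrite add0r.
apply: is_derive_eq (is_derive_mulf d1 (is_derive_flat 1 x)) _.
have [x0|x0] := lerP x 0; first by rewrite /dprofile !flat_le0 // !(mulr0, mul0r) addr0.
rewrite (_ : 'X^2 * _ = 'X^2); last by rewrite -polyC1 derivC subr0 polyC1 mulr1.
rewrite /dprofile flat1_gt0 // !flat_gt0 // !hornerD hornerX hornerXn -polyC1 hornerC.
have x0' : x != 0 by rewrite gt_eqF.
by field.
Qed.

Lemma is_derive_dprofile x : is_derive x 1 dprofile (ddprofile x).
Proof.
apply: is_derive_eq (is_derive_flat _ x) _; congr (flat _ x).
rewrite !poly.derivE; ring.
Qed.

Lemma profile_ge0 x : 0 <= profile x.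
Proof.
have [x0|x0] := lerP x 0; first by rewrite profile_le0.
by rewrite /profile flat1_gt0 // mulr_ge0 ?expR_ge0 // addr_ge0 // ltW.
Qed.

(** Multiplied by [L] this reads [F >= - s], that is [v >= 0]. *)
Lemma profile_ge x : x - 1 <= profile x.
Proof.
have [x1|x1] := lerP x 1; first by rewrite (le_trans _ (profile_ge0 x)) // subr_le0.
have x0 : 0 < x by lra.
rewrite /profile flat1_gt0 //.
have h : 1 - x^-1 <= expR (- x^-1) by exact: expR_ge1Dx.
have {}h : (1 + x) * (1 - x^-1) <= (1 + x) * expR (- x^-1) by rewrite ler_wpM2l //; lra.
apply: le_trans h.
have -> : (1 + x) * (1 - x^-1) = x - x^-1 by field; rewrite gt_eqF.
by rewrite lerD2l lerN2 invf_le1 // ltW.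
Qed.

Lemma dprofile_ge0 x : 0 <= dprofile x.
Proof.
have [x0|x0] := lerP x 0; first by rewrite /dprofile flat_le0.
have y0 : 0 < x^-1 by rewrite invr_gt0.
rewrite /dprofile flat_gt0 // !hornerE mulr_ge0 ?expR_ge0 //; nra.
Qed.

(** This is [v' >= -1]. The bound [1] would fail, since [dprofile] reaches [3/e] at [x = 1]. *)
Lemma dprofile_le2 x : dprofile x <= 2.
Proof.
have [x0|x0] := lerP x 0; first by rewrite /dprofile flat_le0.
have y0 : 0 < x^-1 by rewrite invr_gt0.
rewrite /dprofile flat_gt0 // !hornerE expRN; set y := x^-1 in y0 *.
rewrite ler_pdivrMr ?expR_gt0 //.
have -> : y = 3%:R * (y / 3%:R) by field.
rewrite expRM_natl; set z := y / 3%:R; have z0 : 0 < z by rewrite divr_gt0.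
have h : (1 + z) ^+ 3 <= expR z ^+ 3.
  by rewrite lerXn2r ?nnegrE ?expR_ge0 ?expR_ge1Dx //; lra.
apply: (@le_trans _ _ (2 * (1 + z) ^+ 3)); last by rewrite ler_pM2l.
(* With [y = 3 z], the difference [2 (1 + z)^3 - (9 z^2 + 3 z + 1)] equals
   [2 z (z - 3/4)^2 + 15 z / 8 + 1]. *)
have : 0 <= z * ((z - 3/4) ^+ 2) by rewrite mulr_ge0 ?sqr_ge0 // ltW.
nra.
Qed.

Lemma ddprofile_le x : ddprofile x <= 24%:R.
Proof.
have [x0|x0] := lerP x 0; first by rewrite /ddprofile flat_le0.
have y0 : 0 < x^-1 by rewrite invr_gt0.
rewrite /ddprofile flat_gt0 // !hornerE expRN; set y := x^-1 in y0 *.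
rewrite ler_pdivrMr ?expR_gt0 //.
(* The bound [24] is [4!], from [y^4 / 4! <= e^y]. *)
have := @expR_ge1Dxn R y 3 (ltW y0).
rewrite (_ : 4`! = 24%N) // => h.
have h3 : 0 <= y ^+ 3 by rewrite exprn_ge0 // ltW.
lra.
Qed.

Lemma ddprofile_le0 x : ~~ (0 < x < 1) -> ddprofile x <= 0.
Proof.
have [x0|x0] := lerP x 0; first by rewrite /ddprofile flat_le0.
rewrite /= -leNgt => x1; have y0 : 0 < x^-1 by rewrite invr_gt0.
have y1 : x^-1 <= 1 by rewrite invf_le1.
rewrite /ddprofile flat_gt0 // !hornerE pmulr_lle0 ?expR_gt0 // subr_le0.
by apply: ler_wiXn2l => //; exact: ltW.
Qed.

End Profile.

(** * Curvature of conformally flat metrics *)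

Section DotProduct.
Context {R : realType} {m : nat}.
Implicit Types (x y v w : 'rV[R]_m) (a : R).

Lemma dotvC x y : dotv x y = dotv y x.
Proof. by apply: eq_bigr => i _; rewrite mulrC. Qed.

Lemma dotvDl x y v : dotv (x + y) v = dotv x v + dotv y v.
Proof. by rewrite -big_split; apply: eq_bigr => i _; rewrite mxE mulrDl. Qed.

Lemma dotvZl a x v : dotv (a *: x) v = a * dotv x v.
Proof. by rewrite mulr_sumr; apply: eq_bigr => i _; rewrite mxE mulrA. Qed.

Lemma dotvDr x y v : dotv v (x + y) = dotv v x + dotv v y.
Proof. by rewrite dotvC dotvDl !(dotvC v). Qed.

Lemma dotvZr a x v : dotv v (a *: x) = a * dotv v x.
Proof. by rewrite dotvC dotvZl (dotvC v). Qed.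

Lemma dotvNl x v : dotv (- x) v = - dotv x v.
Proof. by rewrite -scaleN1r dotvZl mulN1r. Qed.

Lemma dotvNr x v : dotv v (- x) = - dotv v x.
Proof. by rewrite dotvC dotvNl (dotvC v). Qed.

Lemma dotv0l v : dotv 0 v = 0.
Proof. by rewrite -(scale0r (0 : 'rV[R]_m)) dotvZl mul0r. Qed.

Lemma dotv_ge0 x : 0 <= dotv x x.
Proof. by apply: sumr_ge0 => i _; rewrite -expr2 sqr_ge0. Qed.

Lemma dotv_eq0 x : (dotv x x == 0) = (x == 0).
Proof.
apply/idP/eqP => [|->]; last by rewrite dotv0l.
rewrite psumr_eq0 => [/allP h|i _]; last by rewrite -expr2 sqr_ge0.
apply/rowP => i; rewrite mxE; have := h i (mem_index_enum i).
by rewrite -expr2 sqrf_eq0 => /eqP.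
Qed.

Lemma dotv_gt0 x : (0 < dotv x x) = (x != 0).
Proof. by rewrite lt_neqAle dotv_ge0 andbT eq_sym dotv_eq0. Qed.

Lemma dotv_delta x (i : 'I_m) : dotv x (delta_mx 0 i) = x 0 i.
Proof.
rewrite /dotv (bigD1 i) //= big1 => [|j ji]; last by rewrite mxE (negbTE ji) andbF mulr0.
by rewrite mxE !eqxx mulr1 addr0.
Qed.

Lemma coord_sqr_le x (i : 'I_m) : x 0 i ^+ 2 <= dotv x x.
Proof.
rewrite /dotv (bigD1 i) //= -expr2 lerDl sumr_ge0 // => j _.
by rewrite -expr2 sqr_ge0.
Qed.

(** The vector is the component of [x] orthogonal to [y], scaled by [dotv y y] to avoid division.
    Its squared length yields both the Cauchy-Schwarz inequality and the positivity of the Gram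
    determinant. *)
Lemma gram2E x y :
  dotv (dotv y y *: x - dotv x y *: y) (dotv y y *: x - dotv x y *: y) =
  dotv y y * (dotv x x * dotv y y - dotv x y ^+ 2).
Proof.
rewrite !(dotvDl, dotvDr, dotvNl, dotvNr, dotvZl, dotvZr) (dotvC y x); ring.
Qed.

Lemma CauchySchwarz_dotv x y : dotv x y ^+ 2 <= dotv x x * dotv y y.
Proof.
have [/eqP|y0] := boolP (dotv y y == 0).
  move=> /eqP; rewrite dotv_eq0 => /eqP ->; by rewrite dotvC !dotv0l expr0n mulr0.
have y1 : 0 < dotv y y by rewrite lt_neqAle dotv_ge0 eq_sym y0.
by rewrite -subr_ge0 -(pmulr_rge0 _ y1) -gram2E dotv_ge0.
Qed.

Lemma gram2_gt0 v w : row_free (col_mx v w) ->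
  0 < dotv v v * dotv w w - dotv v w ^+ 2.
Proof.
move=> fr.
have comb a b : a *: v + b *: w = 0 -> b = 0 /\ a = 0.
  move=> ab0; pose r : 'rV[R]_(1 + 1) := row_mx a%:M b%:M.
  have : r *m col_mx v w = 0 by rewrite mul_row_col !mul_scalar_mx.
  move=> /eqP; rewrite mulmx_free_eq0 // => /eqP r0.
  have := congr1 (fun M : 'rV[R]_(1 + 1) => lsubmx M 0 0) r0.
  have := congr1 (fun M : 'rV[R]_(1 + 1) => rsubmx M 0 0) r0.
  by rewrite row_mxKl row_mxKr !linear0 !mxE !eqxx /= !mulr1n.
have w0 : 0 < dotv w w.
  rewrite dotv_gt0; apply/eqP => w0; have := comb 0 1.
  by rewrite w0 scale0r scaler0 addr0 => /(_ erefl) [/eqP]; rewrite oner_eq0.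
rewrite -(pmulr_rgt0 _ w0) -gram2E dotv_gt0; apply/eqP.
rewrite -scaleNr => /comb [_ /eqP]; by rewrite gt_eqF.
Qed.

(** Divided by the Gram determinant of [v, w], this is the squared length of the projection of [x]
    to their plane. It is nonnegative as the squared length of [dotv x v *: w - dotv x w *: v]. *)
Lemma plane_proj_ge0 x v w : 0 <=
  dotv x v ^+ 2 * dotv w w + dotv x w ^+ 2 * dotv v v
  - 2 * dotv x v * dotv x w * dotv v w.
Proof.
have := dotv_ge0 (dotv x v *: w - dotv x w *: v).
rewrite !(dotvDl, dotvDr, dotvNl, dotvNr, dotvZl, dotvZr) (dotvC w v) => h.
by apply: le_trans h _; rewrite le_eqVlt; apply/orP; left; apply/eqP; ring.
Qed.

(* Equivalent to the nonnegativity of the Gram determinant of [x, v, w]. *)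
Lemma plane_proj_le x v w : let D := dotv v v * dotv w w - dotv v w ^+ 2 in
  0 < D ->
  dotv x v ^+ 2 * dotv w w + dotv x w ^+ 2 * dotv v v
  - 2 * dotv x v * dotv x w * dotv v w <= dotv x x * D.
Proof.
move=> D D0; rewrite -subr_ge0 -(pmulr_rge0 _ D0).
pose al := dotv x v * dotv w w - dotv x w * dotv v w.
pose be := dotv x w * dotv v v - dotv x v * dotv v w.
have := dotv_ge0 (D *: x - al *: v - be *: w).
rewrite !(dotvDl, dotvDr, dotvNl, dotvNr, dotvZl, dotvZr).
rewrite (dotvC w v) (dotvC v x) (dotvC w x) => h.
apply: le_trans h _; rewrite le_eqVlt; apply/orP; left; apply/eqP.
rewrite /al /be /D; ring.
Qed.

End DotProduct.

Section ConformallyFlat.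
Context {R : realType} {n : nat}.
Implicit Types (F : 'rV[R]_n -> R) (u v w y : 'rV[R]_n) (i j k l m : 'I_n).

Definition flat_conformal F u : 'M[R]_n := (expR (2 * F u))%:M.

Local Notation d_ i j := ((i == j)%:R : R).

Lemma sum_delta i (a : 'I_n -> R) : \sum_m d_ m i * a m = a i.
Proof.
rewrite (bigD1 i) //= eqxx mul1r big1 ?addr0 // => m mi.
by rewrite (negbTE mi) mul0r.
Qed.

Lemma sum_delta' i (a : 'I_n -> R) : \sum_m d_ i m * a m = a i.
Proof. by rewrite -[RHS]sum_delta; apply: eq_bigr => m _; rewrite eq_sym. Qed.

Section Christoffel.
Context (F : 'rV[R]_n -> R) (P : 'I_n -> 'rV[R]_n -> R).

Lemma christoffel_conformal u k i j :
  (forall i, is_derive u (delta_mx 0 i) F (P i u)) ->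
  christoffel (flat_conformal F) k i j u =
  P i u * d_ k j + P j u * d_ k i - P k u * d_ i j.
Proof.
move=> dF.
have pdG i' j' l' : pd i' (fun w => flat_conformal F w j' l') u =
    2 * P i' u * expR (2 * F u) * d_ j' l'.
  have dG : is_derive u (delta_mx 0 i') (fun w => d_ j' l' * expR (2 * F w))
      (d_ j' l' * (expR (2 * F u) * (2 * P i' u))).
    exact: (is_derive_cmul _ (is_derive_compR (is_derive_cmul 2 (dF i')) (is_derive_expR _))).
  rewrite /pd (_ : (fun w => _) = (fun w => d_ j' l' * expR (2 * F w))).
    by case: dG => _ ->; ring.
  by apply/funext => w; rewrite /flat_conformal mxE (mulr_natl (expR _)).
rewrite /christoffel.
under eq_bigr do rewrite !pdG {1}/flat_conformal invmx_scalar mxE -(mulr_natl (_^-1)) -mulrA.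
rewrite sum_delta'.
have e0 : expR (2 * F u) != 0 by rewrite gt_eqF // expR_gt0.
rewrite (eq_sym j k) (eq_sym i k).
by field.
Qed.

(** [B] is the Hessian of [F] minus [dF] tensor [dF]. Curvature differentiates the Christoffel
    symbols, so the gradient [P] must be known on a neighbourhood, its derivatives [Q] only at
    [u]. *)
Lemma riemann_conformal (U : set 'rV[R]_n) u (Q : 'I_n -> 'I_n -> R) l k i j :
  open_nbhs u U ->
  (forall w i, U w -> is_derive w (delta_mx 0 i) F (P i w)) ->
  (forall i j, is_derive u (delta_mx 0 i) (P j) (Q i j)) ->
  (forall i j, Q i j = Q j i) ->
  let B i j := Q i j - P i u * P j u in
  riemann (flat_conformal F) l k i j u =
  d_ l j * B i k - d_ j k * B i l - d_ l i * B j k + d_ i k * B j l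
  - (\sum_m P m u ^+ 2) * (d_ l i * d_ j k - d_ l j * d_ i k).
Proof.
move=> [oU Uu] dF dP Qs B.
have dG i' l' j' k' : pd i' (christoffel (flat_conformal F) l' j' k') u =
    Q i' j' * d_ l' k' + Q i' k' * d_ l' j' - Q i' l' * d_ j' k'.
  have dH : is_derive u (delta_mx 0 i')
     (fun w => d_ l' k' * P j' w + d_ l' j' * P k' w + (- d_ j' k') * P l' w)
     (d_ l' k' * Q i' j' + d_ l' j' * Q i' k' + (- d_ j' k') * Q i' l').
    exact: (is_derive_addf (is_derive_addf (is_derive_cmul _ (dP _ _))
      (is_derive_cmul _ (dP _ _))) (is_derive_cmul _ (dP _ _))).
  rewrite /pd.
  have -> : Q i' j' * d_ l' k' + Q i' k' * d_ l' j' - Q i' l' * d_ j' k' =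
      d_ l' k' * Q i' j' + d_ l' j' * Q i' k' + (- d_ j' k') * Q i' l' by ring.
  case: dH => _ <-; apply: near_eq_derive.
  apply: filterS (open_nbhs_nbhs (conj oU Uu)) => w Uw.
  rewrite (christoffel_conformal _ _ _ (fun i => dF w i Uw)); ring.
pose T := \sum_m P m u ^+ 2.
have GG i' j' : \sum_m christoffel (flat_conformal F) l i' m u *
      christoffel (flat_conformal F) m j' k u =
    P i' u * (P j' u * d_ l k + P k u * d_ l j' - P l u * d_ j' k)
    + d_ l i' * (2 * P j' u * P k u - d_ j' k * T)
    - P l u * (P j' u * d_ i' k + P k u * d_ i' j' - P i' u * d_ j' k).
  pose X m := P j' u * d_ m k + P k u * d_ m j' - P m u * d_ j' k.
  transitivity (P i' u * (\sum_m d_ l m * X m) + d_ l i' * (\sum_m P m u * X m)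
     + (- P l u) * (\sum_m d_ i' m * X m)).
    rewrite !mulr_sumr -!big_split /=; apply: eq_bigr => m _.
    by rewrite !(christoffel_conformal _ _ _ (fun i => dF u i Uu)) -/(X m); ring.
  rewrite !sum_delta'.
  have -> : \sum_m P m u * X m = 2 * P j' u * P k u - d_ j' k * T.
    transitivity (P j' u * (\sum_m d_ m k * P m u) + P k u * (\sum_m d_ m j' * P m u)
       + (- d_ j' k) * T).
      rewrite /T !mulr_sumr -!big_split /=; apply: eq_bigr => m _.
      by rewrite /X; ring.
    by rewrite !sum_delta; ring.
  by rewrite /X; ring.
rewrite /riemann !dG sumrB !GG -/T /B.
rewrite (Qs j i) (eq_sym j i).
ring.
Qed.

End Christoffel.

Lemma inner_at_conformal F u v w :
  inner_at (flat_conformal F) u v w = expR (2 * F u) * dotv v w.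
Proof.
rewrite /inner_at /flat_conformal -scalemx1 -scalemxAr mulmx1 -scalemxAl !mxE.
by congr (_ * _); apply: eq_bigr => i _; rewrite mxE.
Qed.

Lemma is_derive_dotv (V : normedModType R) (m0 : nat) (f g : V -> 'rV[R]_m0) a b d e :
  is_derive a b f d -> is_derive a b g e ->
  is_derive a b (fun z => dotv (f z) (g z)) (dotv (f a) e + dotv d (g a)).
Proof.
move=> /is_derive_rowP df /is_derive_rowP dg.
rewrite /dotv -big_split /=.
apply: is_derive_sumf => i; apply: is_derive_eq (is_derive_mulf (df i) (dg i)) _.
by rewrite [_ * d _ _]mulrC.
Qed.

Lemma is_derive_sqdist (p u v : 'rV[R]_n) :
  is_derive u v (fun w => dotv (w - p) (w - p)) (2 * dotv (u - p) v).
Proof.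
have d : is_derive u v (fun w => w - p) v.
  by apply: is_derive_eq; rewrite ?subr0 ?addr0.
have h := is_derive_dotv d d.
rewrite (_ : 2 * _ = dotv (u - p) v + dotv v (u - p)) //.
by rewrite (dotvC v); ring.
Qed.

(* [sigma] is twice the derivative of the profile of [F] with respect to the
   squared distance to [p]. *)
Lemma radial_sect_curv (U : set 'rV[R]_n) F p u v w (sigma : R -> R) d :
  let y := u - p in let q := dotv y y in
  let Q := dotv y v ^+ 2 * dotv w w + dotv y w ^+ 2 * dotv v v
    - 2 * dotv y v * dotv y w * dotv v w in
  let D := dotv v v * dotv w w - dotv v w ^+ 2 in
  open_nbhs u U ->
  (forall z i, U z -> is_derive z (delta_mx 0 i) F
     (sigma (dotv (z - p) (z - p)) * (z - p) 0 i)) ->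
  is_derive q 1 sigma d -> 0 < D ->
  sect_curv (flat_conformal F) u v w =
  - ((2 * d - sigma q ^+ 2) * (Q / D) + 2 * sigma q + sigma q ^+ 2 * q)
    / expR (2 * F u).
Proof.
move=> y q Q D oU dF ds D0.
pose P i z := sigma (dotv (z - p) (z - p)) * (z - p) 0 i.
(* The gradient of [F] is [sigma q] times [y], so [QQ] is its Hessian. *)
pose QQ i j := 2 * d * y 0 i * y 0 j + sigma q * d_ i j.
have dP i j : is_derive u (delta_mx 0 i) (P j) (QQ i j).
  have d1 := is_derive_compR (is_derive_sqdist p u (delta_mx 0 i)) ds.
  have d2 : is_derive u (delta_mx 0 i) (fun z => (z - p) 0 j) (d_ i j).
    have := is_derive_addf (is_derive_coord 0 j u (delta_mx 0 i))
      (is_derive_cst (- p 0 j) u (delta_mx 0 i)).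
    rewrite mxE eqxx /= addr0 (eq_sym i) (_ : (fun _ => _) = fun z => (z - p) 0 j) //.
    by apply/funext => z; rewrite !mxE.
  apply: is_derive_eq (is_derive_mulf d1 d2) _.
  by rewrite dotv_delta /QQ /= -/y -/q; ring.
have Rm l k i j := riemann_conformal l k i j oU dF dP
  (fun i j => ltac:(rewrite /QQ (eq_sym i); ring) : QQ i j = QQ j i).
pose b := 2 * d - sigma q ^+ 2; pose E := 2 * sigma q + sigma q ^+ 2 * q.
have {}Rm l k i j : riemann (flat_conformal F) l k i j u =
   b * (d_ l j * (y 0 i * y 0 k) - d_ j k * (y 0 i * y 0 l) - d_ l i * (y 0 j * y 0 k)
     + d_ i k * (y 0 j * y 0 l)) + E * (d_ l j * d_ i k - d_ j k * d_ l i).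
  rewrite Rm /QQ /P -/y -/q (_ : \sum_m _ = sigma q ^+ 2 * q); last first.
    rewrite /q /dotv mulr_sumr; apply: eq_bigr => m _; rewrite -/y -/q; ring.
  by rewrite /b /E (eq_sym i l) (eq_sym j l); ring.
have [yv Eyv] : exists t, dotv y v = t by eexists.
have [yw Eyw] : exists t, dotv y w = t by eexists.
have [ww Eww] : exists t, dotv w w = t by eexists.
have [vw Evw] : exists t, dotv v w = t by eexists.
have S l : curvature_op (flat_conformal F) u v w w 0 l =
   b * (w 0 l * yv * yw - ww * yv * y 0 l
     - v 0 l * yw ^+ 2 + vw * yw * y 0 l)
   + E * (w 0 l * vw - ww * v 0 l).
  (* The triple sum is contracted one index at a time, over [k], then [j], then [i]: Kronecker
     deltas select a coordinate, and products of coordinates sum up to scalar products. *)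
  rewrite mxE.
  have S1 i j : \sum_k riemann (flat_conformal F) l k i j u * v 0 i * w 0 j * w 0 k =
     v 0 i * w 0 j * (b * (d_ l j * y 0 i * yw - w 0 j * y 0 i * y 0 l
       - d_ l i * y 0 j * yw + w 0 i * y 0 j * y 0 l)
       + E * (d_ l j * w 0 i - w 0 j * d_ l i)).
    transitivity (v 0 i * w 0 j * (b * (d_ l j * y 0 i - d_ l i * y 0 j)) * (\sum_k y 0 k * w 0 k)
      + (v 0 i * w 0 j * (- b * y 0 i * y 0 l - E * d_ l i)) * (\sum_k d_ j k * w 0 k)
      + (v 0 i * w 0 j * (b * y 0 j * y 0 l + E * d_ l j)) * (\sum_k d_ i k * w 0 k)).
      rewrite !mulr_sumr -!big_split /=; apply: eq_bigr => k _.
      by rewrite Rm; ring.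
    by rewrite !sum_delta' -/(dotv y w) Eyw; ring.
  have S2 i : \sum_j \sum_k riemann (flat_conformal F) l k i j u * v 0 i * w 0 j * w 0 k =
     v 0 i * (b * (w 0 l * y 0 i * yw - ww * y 0 i * y 0 l
       - d_ l i * yw ^+ 2 + w 0 i * yw * y 0 l)
       + E * (w 0 l * w 0 i - ww * d_ l i)).
    transitivity ((v 0 i * (b * y 0 i * yw + E * w 0 i)) * (\sum_j d_ l j * w 0 j)
      + (v 0 i * (- b * y 0 i * y 0 l - E * d_ l i)) * (\sum_j w 0 j * w 0 j)
      + (v 0 i * b * (- d_ l i * yw + w 0 i * y 0 l)) * (\sum_j y 0 j * w 0 j)).
      rewrite !mulr_sumr -!big_split /=; apply: eq_bigr => j _.
      by rewrite S1; ring.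
    by rewrite !sum_delta' -/(dotv y w) Eyw -/(dotv w w) Eww; ring.
  under eq_bigr do rewrite S2.
  transitivity ((b * (w 0 l * yw - ww * y 0 l)) * (\sum_i y 0 i * v 0 i)
      + (- b * yw ^+ 2 - E * ww) * (\sum_i d_ l i * v 0 i)
      + (b * yw * y 0 l + E * w 0 l) * (\sum_i v 0 i * w 0 i)).
    rewrite !mulr_sumr -!big_split /=; apply: eq_bigr => i _; ring.
  by rewrite !sum_delta' -/(dotv y v) Eyv -/(dotv v w) Evw; ring.
rewrite /sect_curv !inner_at_conformal.
have -> : dotv (curvature_op (flat_conformal F) u v w w) v = - (b * Q + E * D).
  transitivity ((b * yv * yw + E * vw) * (\sum_l w 0 l * v 0 l)
     + (b * (vw * yw - ww * yv)) * (\sum_l y 0 l * v 0 l)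
     + (- b * yw ^+ 2 - E * ww) * (\sum_l v 0 l * v 0 l)).
    rewrite !mulr_sumr -!big_split /=; apply: eq_bigr => l _; rewrite S; ring.
  by rewrite -/(dotv w v) -/(dotv y v) -/(dotv v v) (dotvC w v) /Q /D Eyv Eyw Eww Evw; ring.
have e0 : expR (2 * F u) != 0 by rewrite gt_eqF // expR_gt0.
have D0' : D != 0 by rewrite gt_eqF.
rewrite -/b -/E.
have -> : expR (2 * F u) * dotv v v * (expR (2 * F u) * dotv w w) -
   (expR (2 * F u) * dotv v w) ^+ 2 = expR (2 * F u) ^+ 2 * D by rewrite /D; ring.
rewrite -[_ + 2 * sigma q + _]addrA -/E.
by field; rewrite D0' e0.
Qed.

End ConformallyFlat.

(** * Stereographic projection *)

Section Stereographic.
Context {R : realType} {n : nat}.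
Implicit Types (x y : 'rV[R]_n.+1) (u v w : 'rV[R]_n).

Definition tailv x : 'rV[R]_n := \row_j x 0 (lift ord0 j).

Lemma tlE x j : tailv x 0 j = x 0 (lift ord0 j).
Proof. by rewrite mxE. Qed.

Lemma dotv_recl x y : dotv x y = x 0 0 * y 0 0 + dotv (tailv x) (tailv y).
Proof.
by rewrite /dotv big_ord_recl; congr (_ + _); apply: eq_bigr => j _; rewrite !tlE.
Qed.

Lemma eq_hd_tl x y : x 0 0 = y 0 0 -> tailv x = tailv y -> x = y.
Proof.
move=> h /rowP t; apply/rowP => i.
by have [j ->|->] := unliftP ord0 i; rewrite // -!tlE.
Qed.

(** Its square is the factor by which the chart pulls the round metric back to a multiple of the
    Euclidean one. *)
Definition scal u : R := 2 / (1 + dotv u u).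

Lemma addr1_dotv_gt0 u : 0 < 1 + dotv u u.
Proof. by rewrite ltr_pwDl // dotv_ge0. Qed.

Lemma scal_gt0 u : 0 < scal u.
Proof. by rewrite divr_gt0 // addr1_dotv_gt0. Qed.

Lemma stereo_hd u : stereo false u 0 0 = 1 - scal u.
Proof.
have q0 : 1 + dotv u u != 0 by rewrite gt_eqF // addr1_dotv_gt0.
rewrite /stereo !mxE; case: splitP => [i _|j] //=; rewrite mxE expr0 /scal.
by field.
Qed.

Lemma stereo_tl u : tailv (stereo false u) = scal u *: u.
Proof.
apply/rowP => j; rewrite tlE /stereo !mxE.
case: splitP => [i|k /= /eqP]; first by rewrite (ord1 i).
rewrite /bump /= eqSS => /eqP/val_inj <-; rewrite mxE /scal; ring.
Qed.

Definition unstereo x : 'rV[R]_n := (1 - x 0 0)^-1 *: tailv x.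

Lemma stereoK : cancel (stereo false) unstereo.
Proof.
move=> u; rewrite /unstereo stereo_hd stereo_tl opprB addrC subrK scalerA mulVf ?scale1r //.
by rewrite gt_eqF // scal_gt0.
Qed.

Lemma dotv_unstereo x : dotv x x = 1 -> x 0 0 != 1 ->
  1 + dotv (unstereo x) (unstereo x) = 2 / (1 - x 0 0).
Proof.
move=> xx x1; have x1' : 1 - x 0 0 != 0 by rewrite subr_eq0 eq_sym.
rewrite /unstereo dotvZl dotvZr.
have -> : dotv (tailv x) (tailv x) = 1 - x 0 0 ^+ 2 by rewrite -xx dotv_recl; ring.
by field.
Qed.

Lemma scal_unstereo x : dotv x x = 1 -> x 0 0 != 1 -> scal (unstereo x) = 1 - x 0 0.
Proof.
move=> xx x1; have x1' : 1 - x 0 0 != 0 by rewrite subr_eq0 eq_sym.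
by rewrite /scal dotv_unstereo //; field.
Qed.

Lemma unstereoK x : dotv x x = 1 -> x 0 0 != 1 -> stereo false (unstereo x) = x.
Proof.
move=> xx x1; have x1' : 1 - x 0 0 != 0 by rewrite subr_eq0 eq_sym.
apply: eq_hd_tl; first by rewrite stereo_hd scal_unstereo // opprB addrC subrK.
by rewrite stereo_tl scal_unstereo // /unstereo scalerA mulfV ?scale1r.
Qed.

Lemma stereo_sphere u : sphere R n (stereo false u).
Proof.
rewrite /sphere /= dotv_recl stereo_hd stereo_tl dotvZl dotvZr /scal.
have q0 : 1 + dotv u u != 0 by rewrite gt_eqF // addr1_dotv_gt0.
by field.
Qed.

Lemma stereo_hd_neq1 u : stereo false u 0 0 != 1.
Proof. by rewrite stereo_hd -subr_eq0 addrAC subrr sub0r oppr_eq0 gt_eqF // scal_gt0. Qed.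

Definition dstereo u v : 'rV[R]_n.+1 :=
  (row_mx (const_mx (scal u ^+ 2 * dotv u v))
    (scal u *: v - (scal u ^+ 2 * dotv u v) *: u) : 'rV[R]_(1 + n)).

Lemma dstereo_hd u v : dstereo u v 0 0 = scal u ^+ 2 * dotv u v.
Proof. by rewrite mxE; case: splitP => [i _|j] //=; rewrite mxE. Qed.

Lemma dstereo_tl u v : tailv (dstereo u v) = scal u *: v - (scal u ^+ 2 * dotv u v) *: u.
Proof.
apply/rowP => j; rewrite tlE [LHS]mxE.
case: splitP => [i|k /= /eqP]; first by rewrite (ord1 i).
by rewrite /bump /= eqSS => /eqP/val_inj <-.
Qed.

Lemma dotv_dstereo u v w : dotv (dstereo u v) (dstereo u w) = scal u ^+ 2 * dotv v w.
Proof.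
rewrite dotv_recl !dstereo_hd !dstereo_tl.
rewrite !(dotvDl, dotvDr, dotvNl, dotvNr, dotvZl, dotvZr) (dotvC v u).
have q0 : 1 + dotv u u != 0 by rewrite gt_eqF // addr1_dotv_gt0.
by rewrite /scal; field.
Qed.

Lemma is_derive_stereo (V : normedModType R) (c : V -> 'rV[R]_n) a b v :
  is_derive a b c v ->
  is_derive a b (fun z => stereo false (c z)) (dstereo (c a) v).
Proof.
move=> dc; have q0 : 1 + dotv (c a) (c a) != 0 by rewrite gt_eqF // addr1_dotv_gt0.
have ds : is_derive a b (fun z => scal (c z)) (- (scal (c a) ^+ 2 * dotv (c a) v)).
  have d1 := is_derive_addf (is_derive_cst (1 : R) a b) (is_derive_dotv dc dc).
  have d2 := is_derive_cmul 2 (is_derive_compR d1 (is_derive_invr q0)).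
  apply: is_derive_eq d2 _; rewrite (dotvC v) /scal.
  by field.
apply/is_derive_rowP => i.
have [j ->|->] := unliftP ord0 i.
- rewrite -tlE dstereo_tl.
  rewrite (_ : (fun _ => _) = fun z => scal (c z) * c z 0 j); last first.
    by apply/funext => z; rewrite -tlE stereo_tl mxE.
  move/is_derive_rowP: dc => dc.
  apply: is_derive_eq (is_derive_mulf ds (dc j)) _; rewrite !mxE; ring.
- rewrite dstereo_hd.
  rewrite (_ : (fun _ => _) = fun z => 1 + (- 1) * scal (c z)); last first.
    by apply/funext => z; rewrite stereo_hd mulN1r.
  apply: is_derive_eq (is_derive_addf (is_derive_cst (1 : R) a b) (is_derive_cmul (- 1) ds)) _.
  ring.
Qed.

Definition dunstereo x y : 'rV[R]_n :=
  (1 - x 0 0)^-1 *: tailv y + (y 0 0 / (1 - x 0 0) ^+ 2) *: tailv x.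

Lemma is_derive_unstereo (V : normedModType R) (c : V -> 'rV[R]_n.+1) a b y :
  c a 0 0 != 1 -> is_derive a b c y ->
  is_derive a b (fun z => unstereo (c z)) (dunstereo (c a) y).
Proof.
move=> ca1 /is_derive_rowP dc.
have ca1' : 1 + (- 1) * c a 0 0 != 0 by rewrite mulN1r subr_eq0 eq_sym.
have d1 := is_derive_addf (is_derive_cst (1 : R) a b) (is_derive_cmul (- 1) (dc 0)).
have d2 := is_derive_compR d1 (is_derive_invr ca1').
apply/is_derive_rowP => j.
rewrite (_ : (fun _ => _) = fun z => (1 + (- 1) * c z 0 0)^-1 * c z 0 (lift ord0 j)); last first.
  by apply/funext => z; rewrite !mxE mulN1r.
apply: is_derive_eq (is_derive_mulf d2 (dc (lift ord0 j))) _.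
rewrite /= !mxE !mulN1r exprVn; ring.
Qed.

(** [dunstereo x] acts on all ambient vectors but scales lengths uniformly only on the tangent
    space, whence the condition [dotv x y = 0]. *)
Lemma dotv_dunstereo x y : dotv x x = 1 -> dotv x y = 0 -> x 0 0 != 1 ->
  dotv (dunstereo x y) (dunstereo x y) = dotv y y / (1 - x 0 0) ^+ 2.
Proof.
move=> xx xy x1; have x1' : 1 - x 0 0 != 0 by rewrite subr_eq0 eq_sym.
rewrite /dunstereo !(dotvDl, dotvDr, dotvZl, dotvZr) (dotvC (tailv y)).
have -> : dotv (tailv x) (tailv x) = 1 - x 0 0 ^+ 2 by rewrite -xx dotv_recl; ring.
have -> : dotv (tailv x) (tailv y) = - (x 0 0 * y 0 0).
  by apply/eqP; rewrite -addr_eq0 addrC -dotv_recl xy.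
rewrite [dotv y y]dotv_recl.
by field.
Qed.

(* The second term cancels the conformal factor of the stereographic chart. *)
Definition round_factor (F : 'rV[R]_n -> R) x : R := F (unstereo x) - ln (scal (unstereo x)).

Lemma gram_round_factor F : gram (conformal (round_factor F)) false = flat_conformal F.
Proof.
apply/funext => u; apply/matrixP => i j.
have pdE k : pd k (stereo false) u = dstereo u (delta_mx 0 k).
  by have [_ <-] := is_derive_stereo (is_derive_id u (delta_mx 0 k)).
rewrite /gram /flat_conformal !mxE !pdE /conformal /can dotv_dstereo dotv_delta mxE eqxx /=.
rewrite /round_factor stereoK (eq_sym j) mulrBr expRB.
have s0 := scal_gt0 u.
rewrite [2 * ln _]mulrC -[in expR (ln _ * _)](mulr_natl 1) mulr1 expRM_natr lnK ?posrE //.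
rewrite mulrA mulfVK ?mulr_natr // expf_neq0 // gt_eqF //.
Qed.

End Stereographic.

(** * The conformal factor *)

Section Potential.
Context {R : realType} {n : nat} (i0 : 'I_n).
Implicit Types (u v w : 'rV[R]_n) (k j : nat).

(* The factor [24] is the bound of [ddprofile_le]; with it the curvature of the [k]-th
   neck is at least [- neck_width k ^+ 2], where [neck_width k = 2 ^- k.+1]. *)
Definition neck_len k : nat := (24 * 4 ^ k.+1)%N.

Definition radius k : R := expR (neck_len k)%:R.

(** With the factor [4], and radii growing at least threefold, even the balls of twice the radius
    are disjoint; [near_isolated] uses this margin. *)
Definition center k : 'rV[R]_n := (4 * radius k) *: delta_mx 0 i0.

Definition sqdist k w : R := dotv (w - center k) (w - center k).

(** This is [x = 1 - s/L], where [s = ln q / 2] because [q] is a squared distance. The range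
    [0 < x < 1] is thus the shell [1 < q < radius k ^+ 2]. *)
Definition depth k (q : R) : R := 1 - ln q / (2 * (neck_len k)%:R).

Definition pot k w : R := (neck_len k)%:R * profile (depth k (sqdist k w)).

(* On the ball of radius [radius k] around [center k] (these balls are disjoint) this is
   [pot k]; elsewhere it is [0], since every [pot k] vanishes there. *)
Definition potential w : R := pot (xget 0%N [set k | sqdist k w < radius k ^+ 2]) w.

Lemma neck_len_gt0 k : 0 < (neck_len k)%:R :> R.
Proof. by rewrite ltr0n muln_gt0 expn_gt0. Qed.

Lemma radius_ge1 k : 1 <= radius k.
Proof. by rewrite -expR0 ler_expR ler0n. Qed.

Lemma radius_gt0 k : 0 < radius k.
Proof. exact: expR_gt0. Qed.

Lemma ln_rad2 k : ln (radius k ^+ 2) = 2 * (neck_len k)%:R.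
Proof. by rewrite lnXn ?radius_gt0 // expRK mulr2n; ring. Qed.

Lemma radius_ge3 j k : (j < k)%N -> 3 * radius j <= radius k.
Proof.
move=> jk; rewrite /radius.
have h : (neck_len j + 2 <= neck_len k)%N.
  rewrite /neck_len; apply: (@leq_trans (24 * (4 ^ j.+1).+1)).
    by rewrite mulnS addnC leq_add2r.
  by rewrite leq_mul2l /= ltn_exp2l.
apply: (@le_trans _ _ (expR ((neck_len j)%:R + 2))); last first.
  by rewrite ler_expR -natrD ler_nat.
rewrite expRD mulrC ler_pM2l ?expR_gt0 //.
by apply: le_trans (expR_ge1Dx 2); lra.
Qed.

Lemma radius_sep j k : j != k -> 2 * radius j + 2 * radius k <= `|4 * radius j - 4 * radius k|.
Proof.
rewrite neq_ltn => /orP[] /radius_ge3 h.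
  rewrite ler0_norm; last by have := radius_gt0 j; lra.
  lra.
rewrite ger0_norm; last by have := radius_gt0 k; lra.
lra.
Qed.

Lemma sqdist_ge0 k w : 0 <= sqdist k w. Proof. exact: dotv_ge0. Qed.

Lemma sqdist_gt0 k w : (0 < sqdist k w) = (w != center k).
Proof. by rewrite dotv_gt0 subr_eq0. Qed.

Lemma coord_sqdist k w : (w 0 i0 - 4 * radius k) ^+ 2 <= sqdist k w.
Proof. by have := coord_sqr_le (w - center k) i0; rewrite !mxE !eqxx mulr1. Qed.

Lemma sqdist_sep j k w : j != k -> sqdist k w < (2 * radius k) ^+ 2 -> radius j ^+ 2 < sqdist j w.
Proof.
move=> jk hk; apply: lt_le_trans (coord_sqdist j w).
have h1 : `|w 0 i0 - 4 * radius k| < 2 * radius k.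
  rewrite -(ltr_pXn2r (ltn0Sn 1)) ?nnegrE ?normr_ge0 ?mulr_ge0 ?(ltW (radius_gt0 k)) //.
  by rewrite real_normK ?num_real //; apply: le_lt_trans (coord_sqdist k w) hk.
have h2 := radius_sep jk; have r0 := radius_gt0 j.
have h3 : `|4 * radius j - 4 * radius k| <= `|w 0 i0 - 4 * radius k| + `|w 0 i0 - 4 * radius j|.
  rewrite -[X in `|X|](subrKA (w 0 i0)) addrC; apply: le_trans (ler_normD _ _) _.
  by rewrite lerD // distrC.
rewrite -(real_normK (num_real (w 0 i0 - 4 * radius j))).
rewrite ltr_pXn2r ?nnegrE ?(ltW r0) //.
lra.
Qed.

Lemma pot_out k w : radius k ^+ 2 <= sqdist k w -> pot k w = 0.
Proof.
move=> h; rewrite /pot profile_le0 ?mulr0 // /depth subr_le0 ler_pdivlMr ?mulr_gt0 ?neck_len_gt0 //.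
rewrite mul1r -ln_rad2 ler_ln ?posrE ?exprn_gt0 ?radius_gt0 //.
by apply: lt_le_trans h; rewrite exprn_gt0 ?radius_gt0.
Qed.

Lemma potentialE k w : (forall j, j != k -> radius j ^+ 2 < sqdist j w) ->
  potential w = pot k w.
Proof.
move=> h; rewrite /potential; case: xgetP => [j _ /= hj|/= h0].
  by have [->//|/h] := eqVneq j k; rewrite ltNge (ltW hj).
have out j : radius j ^+ 2 <= sqdist j w by rewrite leNgt; apply/negP; exact: h0.
by rewrite !pot_out.
Qed.

Lemma sqdist_continuous k : continuous (sqdist k).
Proof.
by move=> w; exact: (Ck_on_continuous (Ck_on_sqnorm 0 (center k) openT)).
Qed.

(** Local finiteness of the balls. If [u] is in a doubled ball, that open ball misses all other
    balls. Otherwise [u] is at distance at least [2 * radius j] from every center, and since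
    [radius j] is at least [1], the unit ball around [u] misses them all; any [k] will do. *)
Lemma near_isolated u :
  exists k, \forall w \near u, forall j, j != k -> radius j ^+ 2 < sqdist j w.
Proof.
have [[k hk]|h] := pselect (exists k, sqdist k u < (2 * radius k) ^+ 2).
  exists k; have : \forall w \near u, sqdist k w < (2 * radius k) ^+ 2.
    exact: (cvgr_lt _ (@sqdist_continuous k u)).
  by apply: filterS => w hw j jk; exact: sqdist_sep jk hw.
exists 0%N.
have nu : \forall w \near u, dotv (w - u) (w - u) < 1.
  have c := Ck_on_sqnorm 0 u (@openT 'rV[R]_n).
  by apply: (cvgr_lt _ (Ck_on_continuous (u := u) c I)); rewrite subrr dotv0l.
apply: filterS nu => w hw j _.
have hj : (2 * radius j) ^+ 2 <= sqdist j u by rewrite leNgt; apply/negP => hj; apply: h; exists j.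
have : sqdist j u <= 2 * sqdist j w + 2 * dotv (w - u) (w - u).
  have -> : sqdist j u = dotv ((w - center j) - (w - u)) ((w - center j) - (w - u)).
    by rewrite (_ : w - center j - (w - u) = u - center j) // opprB addrC addrA subrK.
  have := dotv_ge0 ((w - center j) + (w - u)).
  rewrite !(dotvDl (w - center j), dotvDr (w - center j), dotvNl (w - u), dotvNr (w - u)).
  rewrite (dotvC (w - u) (w - center j)) -/(sqdist j w); lra.
have : 1 <= radius j ^+ 2 by rewrite exprn_ege1 // radius_ge1.
move: hj; rewrite exprMn; lra.
Qed.

Lemma pot_ge0 k w : 0 <= pot k w.
Proof. by rewrite mulr_ge0 ?profile_ge0 // ltW ?neck_len_gt0. Qed.

Lemma potential_ge0 w : 0 <= potential w.
Proof. exact: pot_ge0. Qed.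

(* Hence the conformal metric dominates a complete half-cylinder near [center j]. *)
Lemma potential_sqd_ge1 j w : w != center j -> 1 <= expR (2 * potential w) * sqdist j w.
Proof.
rewrite -sqdist_gt0 => q0.
have [h|h] := lerP (radius j ^+ 2) (sqdist j w).
  have e1 : 1 <= expR (2 * potential w).
    by rewrite -expR0 ler_expR mulr_ge0 // potential_ge0.
  by apply: mulr_ege1 => //; apply: le_trans h; rewrite exprn_ege1 // radius_ge1.
rewrite (@potentialE j); last first.
  move=> l lj; apply: sqdist_sep lj _; apply: lt_le_trans h _.
  by rewrite lerXn2r ?nnegrE ?mulr_ge0 ?ltW ?radius_gt0 //; have := radius_gt0 j; lra.
rewrite -[X in _ * X]lnK ?posrE // -expRD -[leLHS]expR0 ler_expR /pot.
have l0 := neck_len_gt0 j.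
have : (neck_len j)%:R * (depth j (sqdist j w) - 1) <=
    (neck_len j)%:R * profile (depth j (sqdist j w)).
  by rewrite ler_pM2l // profile_ge.
have -> : (neck_len j)%:R * (depth j (sqdist j w) - 1) = - ln (sqdist j w) / 2.
  by rewrite /depth; field; rewrite gt_eqF.
lra.
Qed.

(** Twice the derivative of [pot k] in the squared distance, that is the [sigma] of
    [radial_sect_curv]. *)
Definition slope k (q : R) : R := - dprofile (depth k q) / q.

Lemma is_derive_depth k (q : R) : 0 < q ->
  is_derive q 1 (depth k) (- (2 * (neck_len k)%:R * q)^-1).
Proof.
move=> q0; have l0 := neck_len_gt0 k.
rewrite (_ : depth k = fun t => 1 + - (2 * (neck_len k)%:R)^-1 * ln t); last first.
  by apply/funext => t; rewrite /depth; ring.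
have d := is_derive_addf (is_derive_cst (1 : R) q 1)
  (is_derive_cmul (- (2 * (neck_len k)%:R)^-1) (is_derive1_ln q0)).
apply: is_derive_eq d _; field; rewrite !gt_eqF //.
Qed.

Lemma is_derive_pot k w v : w != center k ->
  is_derive w v (pot k) (slope k (sqdist k w) * dotv (w - center k) v).
Proof.
rewrite -sqdist_gt0 => q0; have l0 := neck_len_gt0 k.
have d1 := is_derive_compR (is_derive_sqdist (center k) w v) (is_derive_depth k q0).
have d2 := is_derive_cmul (neck_len k)%:R (is_derive_compR d1 (is_derive_profile _)).
apply: is_derive_eq d2 _; rewrite /slope /= -/(sqdist k w).
by field; rewrite !gt_eqF.
Qed.

Lemma is_derive_slope k (q : R) : 0 < q ->
  is_derive q 1 (slope k)
    ((ddprofile (depth k q) / (2 * (neck_len k)%:R) + dprofile (depth k q)) / q ^+ 2).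
Proof.
move=> q0; have l0 := neck_len_gt0 k.
have d1 := is_derive_compR (is_derive_depth k q0) (is_derive_dprofile _).
have qn0 : q != 0 by rewrite gt_eqF.
rewrite (_ : slope k = fun t => - 1 * dprofile (depth k t) * t^-1); last first.
  by apply/funext => t; rewrite /slope mulN1r.
have d2 := is_derive_mulf (is_derive_cmul (- 1) d1) (is_derive_invr qn0).
by apply: is_derive_eq d2 _; rewrite /=; field; rewrite !gt_eqF.
Qed.

Definition neck_width k : R := 2^-1 ^+ k.+1.

Lemma neck_width2 k : 24 / (neck_len k)%:R = neck_width k ^+ 2.
Proof.
rewrite /neck_width -exprM mulnC exprM (_ : 2^-1 ^+ 2 = 4^-1 :> R); last by field.
by rewrite /neck_len natrM natrX exprVn; field; rewrite expf_neq0.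
Qed.

Lemma sect_curv_potential_ge k u v w : u != center k ->
  (\forall z \near u, forall j, j != k -> radius j ^+ 2 < sqdist j z) ->
  row_free (col_mx v w) ->
  (if 1 < sqdist k u < radius k ^+ 2
   then - (neck_width k ^+ 2 / (sqdist k u * expR (2 * potential u))) else 0)
  <= sect_curv (flat_conformal potential) u v w.
Proof.
move=> uk near_u /gram2_gt0 D0.
have near_u' : \forall z \near u,
    (forall j, j != k -> radius j ^+ 2 < sqdist j z) /\ 0 < sqdist k z.
  apply: filterI near_u _; apply: (cvgr_gt _ (@sqdist_continuous k u)).
  by rewrite sqdist_gt0.
have [U oU UP] : exists2 U, open_nbhs u U & forall z, U z ->
    (forall j, j != k -> radius j ^+ 2 < sqdist j z) /\ 0 < sqdist k z.
  have : nbhs u [set z | (forall j, j != k -> radius j ^+ 2 < sqdist j z) /\ 0 < sqdist k z].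
    exact: near_u'.
  by rewrite nbhsE => -[U oU UP]; exists U.
have q0 : 0 < sqdist k u by rewrite sqdist_gt0.
have l0 := neck_len_gt0 k.
have dF z i : U z -> is_derive z (delta_mx 0 i) potential
    (slope k (dotv (z - center k) (z - center k)) * (z - center k) 0 i).
  move=> Uz; have := is_derive_pot (delta_mx 0 i) (w := z) (k := k).
  rewrite -sqdist_gt0 dotv_delta => /(_ (UP z Uz).2).
  apply: near_eq_is_derive; have [oU' _] := oU.
  apply: filterS (open_nbhs_nbhs (conj oU' Uz)) => y Uy.
  by rewrite (@potentialE k) //; exact: (UP y Uy).1.
rewrite (radial_sect_curv oU dF (is_derive_slope k q0) D0) -/(sqdist k u).
set q := sqdist k u in q0 *.
set t := _ / (_ * _ - _).
have t0 : 0 <= t by rewrite divr_ge0 ?plane_proj_ge0 // ltW.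
have tq : t <= q by rewrite ler_pdivrMr // plane_proj_le.
have e0 : 0 < expR (2 * potential u) by rewrite expR_gt0.
rewrite /slope; set x := depth k q.
have dp0 := dprofile_ge0 x; have dp2 := dprofile_le2 x.
rewrite ler_pdivlMr //.
(* [s] is the squared cosine of the angle between the plane and the radial direction. Up to the
   positive factor [q * expR (2 * potential u)], the curvature is the convex combination of
   [1 - v'^2] and [- v''] with weights [1 - s] and [s]. *)
pose s := t / q; have s0 : 0 <= s by rewrite divr_ge0 // ltW.
have s1 : s <= 1 by rewrite ler_pdivrMr // mul1r.
have -> : - ((2 * ((ddprofile x / (2 * (neck_len k)%:R) + dprofile x) / q ^+ 2) -
        (- dprofile x / q) ^+ 2) * t + 2 * (- dprofile x / q) + (- dprofile x / q) ^+ 2 * q) =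
   (dprofile x * (2 - dprofile x) * (1 - s) - ddprofile x / (neck_len k)%:R * s) / q.
  by rewrite /s; field; rewrite !gt_eqF.
have nn : 0 <= dprofile x * (2 - dprofile x) * (1 - s) by rewrite !mulr_ge0 // subr_ge0.
case: ifPn => [_|out].
  have -> : - (neck_width k ^+ 2 / (q * expR (2 * potential u))) * expR (2 * potential u) =
      - neck_width k ^+ 2 / q by field; rewrite !gt_eqF.
  rewrite ler_pM2r ?invr_gt0 // -neck_width2.
  have : ddprofile x / (neck_len k)%:R * s <= 24 / (neck_len k)%:R * 1.
    have l1 : 0 <= 24 / (neck_len k)%:R :> R by rewrite divr_ge0 // ltW.
    apply: (@le_trans _ _ (24 / (neck_len k)%:R * s)).
      by rewrite ler_wpM2r // ler_pM2r ?invr_gt0 // ddprofile_le.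
    by rewrite ler_wpM2l.
  lra.
rewrite mul0r mulr_ge0 ?invr_ge0 ?(ltW q0) //.
suff : ddprofile x / (neck_len k)%:R * s <= 0 by lra.
rewrite mulr_le0_ge0 // pmulr_lle0 ?invr_gt0 //; apply: ddprofile_le0.
apply: contra out => /andP[x0 x1].
have -> : (1 < q) = (0 < ln q) by rewrite -[in RHS]ln1 ltr_ln ?posrE.
have -> : (q < radius k ^+ 2) = (ln q < 2 * (neck_len k)%:R).
  by rewrite -ln_rad2 ltr_ln ?posrE ?exprn_gt0 ?radius_gt0.
have lq : 0 < 2 * (neck_len k)%:R :> R by rewrite mulr_gt0.
move: x0 x1; rewrite /x /depth subr_gt0 ltr_pdivrMr // mul1r => ->.
rewrite andbT => x1; have : 0 < ln q / (2 * (neck_len k)%:R) by lra.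
by rewrite pmulr_lgt0 // invr_gt0.
Qed.

End Potential.

(** * The singular set, smoothness and the lower curvature bound *)

Section PuncturedSphere.
Context {R : realType} {n : nat} (i0 : 'I_n).
Implicit Types (x : 'rV[R]_n.+1) (u w : 'rV[R]_n).
Local Notation center := (@center R n i0).
Local Notation F := (@potential R n i0).

(** The pole [x 0 0 = 1] is the limit of the other singular points, so closedness forces its
    inclusion. *)
Definition singular_set : set 'rV[R]_n.+1 :=
  [set x | sphere R n x /\ (x 0 0 = 1 \/ exists k, unstereo x = center k)].

Definition regular_set : set 'rV[R]_n.+1 := sphere R n `\` singular_set.

Definition factor : 'rV[R]_n.+1 -> R := round_factor F.

Lemma regP x : regular_set x <-> [/\ sphere R n x, x 0 0 != 1 & forall k, unstereo x != center k].
Proof.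
split=> [[sx nx]|[sx x1 xk]]; split=> //.
- by apply/eqP => x1; apply: nx; split=> //; left.
- by move=> k; apply/eqP => xk; apply: nx; split=> //; right; exists k.
- by move=> [_ [/eqP|[k /eqP]]]; apply/negP.
Qed.

Lemma reg_stereo u : regular_set (stereo false u) <-> forall k, u != center k.
Proof.
split=> [/regP[_ _ h] k|h]; first by have := h k; rewrite stereoK.
by apply/regP; split; [exact: stereo_sphere|exact: stereo_hd_neq1|move=> k; rewrite stereoK].
Qed.

Lemma open_reg : open [set u | forall k, u != center k].
Proof.
rewrite openE => u hu; have [k hk] := near_isolated i0 u.
have : \forall w \near u, (forall j, j != k -> radius j ^+ 2 < sqdist i0 j w) /\ 0 < sqdist i0 k w.
  by apply: filterI hk _; apply: (cvgr_gt _ (@sqdist_continuous R n i0 k u)); rewrite sqdist_gt0.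
apply: filterS => w [h1 h2] j; have [->|jk] := eqVneq j k; first by rewrite -sqdist_gt0.
by rewrite -sqdist_gt0 (lt_trans _ (h1 j jk)) // exprn_gt0 // radius_gt0.
Qed.

Lemma pt_inj : injective center.
Proof.
move=> j k /rowP/(_ i0); rewrite !mxE !eqxx !mulr1 => h.
have [//|jk] := eqVneq j k; exfalso; have := radius_sep (R := R) jk.
by rewrite h subrr normr0; have := radius_gt0 (R := R) j; have := radius_gt0 (R := R) k; lra.
Qed.

Lemma continuous_unstereo x : x 0 0 != 1 -> {for x, continuous (@unstereo R n)}.
Proof.
move=> x1; have x1' : 1 - x 0 0 != 0 by rewrite subr_eq0 eq_sym.
have c1 : {for x, continuous (fun y : 'rV[R]_n.+1 => (1 - y 0 0)^-1 : R)}.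
  have cB : {for x, continuous (fun y : 'rV[R]_n.+1 => 1 - y 0 0 : R)}.
    by apply: continuousB; [exact: cst_continuous|exact: coord_continuous].
  exact: (cvgV x1' cB).
have c2 : {for x, continuous (@tailv R n)}.
  rewrite (_ : @tailv R n = @rsubmx R 1 1 n); last first.
    by apply/funext => y; apply/rowP => j; rewrite !mxE; congr (y 0 _); exact: val_inj.
  by apply: differentiable_continuous; exact: (@differentiable_rsubmx R 1 1 n).
exact: (cvgZ c1 c2).
Qed.

Lemma open_neq m (F0 : 'rV[R]_m -> R) (c : R) :
  (forall y, {for y, continuous F0}) -> open [set y | F0 y != c].
Proof.
move=> cF; rewrite openE => y /= yc.
have c2 : {for y, continuous (fun z => (F0 z - c) ^+ 2)}.
  by apply: (@continuousM _ _ (fun z => F0 z - c) (fun z => F0 z - c));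
    apply: continuousB; try exact: cF; exact: cst_continuous.
have : \forall z \near y, 0 < (F0 z - c) ^+ 2.
  by apply: (cvgr_gt _ c2); rewrite exprn_even_gt0 // subr_eq0.
by apply: filterS => z /=; rewrite exprn_even_gt0 // subr_eq0.
Qed.

Lemma closed_sing : closed singular_set.
Proof.
pose V : set 'rV[R]_n.+1 := [set x : 'rV[R]_n.+1 | x 0 0 != 1 /\ forall k, unstereo x != center k].
have oV : open V.
  rewrite openE => x [x1 xk].
  have n1 : \forall y \near (x : 'rV[R]_n.+1), (y : 'rV[R]_n.+1) 0 0 != 1.
    apply: open_nbhs_nbhs; split=> //; apply: open_neq => y; exact: coord_continuous.
  have n2 : \forall y \near (x : 'rV[R]_n.+1), forall k, unstereo y != center k.
    have no : nbhs (unstereo x) [set u | forall k, u != center k].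
      exact: open_nbhs_nbhs (conj open_reg xk).
    exact: (continuous_unstereo x1 no).
  by apply: filterS2 n1 n2 => y.
have oS : open (~` sphere R n).
  rewrite (_ : ~` _ = [set y | dotv y y != 1]); last first.
    by apply/seteqP; split=> y /= /eqP.
  apply: open_neq => y; have := Ck_on_sqnorm 0 0 (@openT 'rV[R]_n.+1).
  under eq_fun do rewrite subr0.
  by move=> C; exact: (Ck_on_continuous C).
have -> : singular_set = ~` (~` sphere R n `|` V).
  apply/seteqP; split=> x.
    by move=> [sx h] [//|[/eqP x1 xk]]; case: h => // -[k /eqP]; apply/negP.
  move=> /not_orP[/contrapT sx nV]; split=> //.
  have [x1|x1] := eqVneq (x 0 0) 1; first by left.
  right; apply: contrapT => nk; apply: nV; split=> // k.
  by apply/eqP => xk; apply: nk; exists k.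
by apply: open_closedC; exact: openU.
Qed.

Lemma infinite_sing : infinite_set singular_set.
Proof.
move=> fS; apply: infinite_nat.
have -> : [set: nat] = (fun k => stereo false (center k)) @^-1` singular_set.
  apply/seteqP; split=> // k _ /=; split; first exact: stereo_sphere.
  by right; exists k; rewrite stereoK.
apply: finite_preimage fS => j k _ _ /(congr1 (@unstereo R n)).
by rewrite !stereoK => /pt_inj.
Qed.

Lemma reg_neq0 : regular_set !=set0.
Proof.
exists (stereo false 0); apply/reg_stereo => k; apply/eqP => /rowP/(_ i0).
rewrite !mxE !eqxx mulr1 => /esym/eqP.
by rewrite gt_eqF // mulr_gt0 // radius_gt0.
Qed.

Lemma chart_at_reg x : regular_set x -> chart_at x = false.
Proof.
move=> /regP[_ x1 _]; apply/negP => /eqP xE; move: x1.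
by rewrite xE /pole mxE; case: splitP => // i _; rewrite mxE expr0 eqxx.
Qed.

Lemma sigma_minus_bound g x (b : R) : 0 <= b ->
  (forall K, sectional_curvatures g x K -> - b <= K) -> 0 <= sigma_minus g x <= b.
Proof.
move=> b0 h; rewrite /sigma_minus; case: asboolP => [_|/existsNP[K /not_implyP[sK /negP]]].
  by rewrite lexx.
rewrite -ltNge => K0.
have lb : has_lbound (sectional_curvatures g x) by exists (- b).
have h1 : inf (sectional_curvatures g x) <= K by exact: ge_inf.
have h2 : - b <= inf (sectional_curvatures g x) by apply: lb_le_inf => //; exists K.
by move: (inf _) h1 h2 => I h1 h2; apply/andP; split; lra.
Qed.

Definition curv_bound k u : R :=
  if 1 < sqdist i0 k u < radius k ^+ 2 then neck_width k ^+ 2 / (sqdist i0 k u * expR (2 * F u))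
  else 0.

Lemma curv_bound_ge0 k u : 0 <= curv_bound k u.
Proof.
rewrite /curv_bound; case: ifP => // _.
by rewrite divr_ge0 ?sqr_ge0 // mulr_ge0 ?sqdist_ge0 // expR_ge0.
Qed.

Lemma sectional_curvatures_ge x k : regular_set x ->
  (\forall z \near unstereo x, forall j, j != k -> radius j ^+ 2 < sqdist i0 j z) ->
  forall K, sectional_curvatures (conformal factor) x K -> - curv_bound k (unstereo x) <= K.
Proof.
move=> rx hk K [u [v [w [xE fr ->]]]].
have [_ _ xk] := (regP x).1 rx.
rewrite chart_at_reg // in xE *; rewrite gram_round_factor.
move: xk hk; rewrite -xE stereoK => xk hk.
apply: le_trans (sect_curv_potential_ge (xk k) hk fr).
by rewrite /curv_bound; case: ifP; rewrite ?oppr0.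
Qed.

Lemma neck_width_gt0 k : 0 < neck_width k :> R.
Proof. by rewrite exprn_gt0 // invr_gt0. Qed.

Lemma neck_width_le1 k : neck_width k <= 1 :> R.
Proof. by rewrite exprn_ile1 ?invr_ge0 // invf_le1 // ler1n. Qed.

(** The bound behind completeness, [potential_sqd_ge1], also keeps the denominator of [curv_bound]
    above [1]; the widths are at most [1]. *)
Lemma sec_bounded_below_factor : sec_bounded_below (conformal factor) regular_set.
Proof.
exists (- 1) => x rx K sK; have [k hk] := near_isolated i0 (unstereo x).
apply: le_trans (sectional_curvatures_ge rx hk sK); rewrite lerN2 /curv_bound.
have [_ _ xk] := (regP x).1 rx.
have q1 := potential_sqd_ge1 (xk k); have w0 := ltW (neck_width_gt0 k).
case: ifP => // _; rewrite mulrC.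
apply: (@le_trans _ _ (1 * 1)); last by rewrite mulr1.
rewrite ler_pM ?invr_ge0 ?mulr_ge0 ?sqdist_ge0 ?expR_ge0 ?sqr_ge0 //.
- by rewrite mulrC invf_le1 // (lt_le_trans _ q1).
- by rewrite expr_le1 // neck_width_le1.
Qed.

Lemma Ck_on_pot k l (U : set 'rV[R]_n) : open U -> (forall w, U w -> w != center l) ->
  Ck_on k U (pot i0 l).
Proof.
move=> oU Ul.
have cq : Ck_on k U (sqdist i0 l) by exact: Ck_on_sqnorm.
have cd : Ck_on k U (fun w => depth l (sqdist i0 l w)).
  rewrite /depth; under eq_fun do rewrite mulrC -mulNr.
  apply: Ck_onD => //; first exact: Ck_on_cst.
  apply: Ck_onM => //; first exact: Ck_on_cst.
  apply: (Ck_on_comp oU (Ck1_ln k) cq) => w /Ul; by rewrite -sqdist_gt0.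
rewrite /pot /profile; apply: Ck_onM => //; first exact: Ck_on_cst.
apply: Ck_onM => //; first by apply: Ck_onD => //; exact: Ck_on_cst.
exact: (Ck_on_comp oU (Ck1_flat k 1) cd).
Qed.

Lemma Ck_on_potential k : Ck_on k [set u | forall j, u != center j] F.
Proof.
apply: Ck_on_local => u uk; have [l] := near_isolated i0 u.
rewrite -[X in X -> _]/(nbhs u [set w | forall j, j != l -> radius j ^+ 2 < sqdist i0 j w]).
rewrite nbhsE => -[W [oW Wu] WP].
exists (W `&` [set u | forall j, u != center j]).
  by split; [apply: openI => //; exact: open_reg|split].
have oWU : open (W `&` [set u | forall j, u != center j]).
  by apply: openI => //; exact: open_reg.
apply: (Ck_on_eq oWU (F := pot i0 l)).
  move=> w; rewrite inE => -[Ww _]; apply/esym/potentialE; exact: WP.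
by apply: Ck_on_pot => // w [_].
Qed.

Lemma smooth_factor : smooth_fun regular_set factor.
Proof.
move=> x rx; have [sx x1 _] := (regP x).1 rx.
exists false, (unstereo x); split; first by rewrite unstereoK.
rewrite (_ : _ @^-1` _ = [set u | forall k, u != center k]); last first.
  by apply/seteqP; split=> u /reg_stereo.
set U := [set u | _]; have oU : open U := open_reg.
move=> k.
rewrite (_ : factor \o _ = fun u => F u + (- 1) * ln (scal u)); last first.
  by apply/funext => u; rewrite /= /factor /round_factor stereoK mulN1r.
apply: Ck_onD => //; first exact: Ck_on_potential.
apply: Ck_onM => //; first exact: Ck_on_cst.
apply: (Ck_on_comp oU (Ck1_ln k)); last by move=> u _; exact: scal_gt0.
have c1 : Ck_on k U (fun u => 1 + dotv u u).
  apply: Ck_onD => //; first exact: Ck_on_cst.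
  by have := Ck_on_sqnorm k 0 oU; under eq_fun do rewrite subr0.
have := Ck_on_comp oU (Ck1_invrX k 2 1) c1.
by apply => u _; exact: addr1_dotv_gt0.
Qed.

End PuncturedSphere.

(** * Integral of the negative part of the curvature *)

Section Integration.
Context {R : realType}.
Local Notation RB := (measurableTypeR R).

(** Cubes replace balls because their measure follows from the iterated product by induction; the
    loss is a constant factor. *)
Definition cube n (c : 'I_n -> R) (b : R) : set (n.-tuple RB) :=
  [set t | forall i, c i - b <= tnth t i <= c i + b].

Lemma cubeS n (c : 'I_n.+1 -> R) b : cube c b =
  @uncons_pair R n @^-1` (`[c ord0 - b, c ord0 + b] `*` cube (fun i => c (lift ord0 i)) b).
Proof.
apply/seteqP; split=> t /=.
  move=> h; split; first by have := h ord0; rewrite in_itv /= (tnth_nth 0).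
  move=> i; have := h (lift ord0 i); rewrite !(tnth_nth 0) /= nth_behead //.
move=> [h0 h] i; have [j ->|->] := unliftP ord0 i.
  by have := h j; rewrite !(tnth_nth 0) /= nth_behead.
by move: h0; rewrite in_itv.
Qed.

Lemma measurable_cube n (c : 'I_n -> R) b : measurable (cube c b).
Proof.
elim: n c => [|n IH] c.
  by rewrite (_ : cube c b = setT) //; apply/seteqP; split=> // t _ -[].
rewrite cubeS -[X in measurable X]setTI; apply: measurable_uncons_pair => //.
by apply: measurableX.
Qed.

Lemma lebesgue_measure_cube n (c : 'I_n -> R) b : 0 <= b ->
  lebesgue_measure_n n (cube c b) = ((2 * b) ^+ n)%:E.
Proof.
move=> b0; elim: n c => [|n IH] c.
  rewrite (_ : cube c b = setT); last by apply/seteqP; split=> // t _ -[].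
  by rewrite expr0 /= diracT.
rewrite cubeS /= /lebesgue_step /pushforward -comp_preimage.
rewrite (_ : _ \o _ = id); last by apply/funext => x /=; exact: uncons_pairK.
rewrite preimage_id product_measure1E //; last exact: measurable_cube.
rewrite exprS EFinM; congr (_ * _)%E; last exact: IH.
apply: etrans (lebesgue_measure_itv _) _ => /=.
move: b0; rewrite le_eqVlt => /predU1P[<-|b0].
  by rewrite subr0 addr0 lte_fin ltxx mulr0.
rewrite lte_fin ifT; last by lra.
by rewrite -EFinB; congr (_%:E); ring.
Qed.

(** The integral of a nonnegative function is a supremum over simple functions below it, hence
    monotone. In this form it applies to the curvature integrand and to the speed of a curve, whose
    measurability is not established. *)
Lemma ge0_le_integral_restrict d (T : measurableType d)
    (mu : {measure set T -> \bar R}) (D E : set T) (f g : T -> \bar R) :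
  (forall x, D x -> (0 <= f x)%E) -> (forall x, E x -> (0 <= g x)%E) ->
  (forall x, ((f \_ D) x <= (g \_ E) x)%E) ->
  (\int[mu]_(x in D) f x <= \int[mu]_(x in E) g x)%E.
Proof.
move=> f0 g0 fg; rewrite !ge0_integralE //.
by apply: ereal_sup_le => _ [h /= hf <-]; exists h => // x; exact: le_trans (fg x).
Qed.

End Integration.

Section FiniteIntegral.
Context {R : realType} {n : nat} (i0 : 'I_n).
Local Notation RB := (measurableTypeR R).
Local Notation F := (@potential R n i0).
Implicit Types (k j : nat) (t : n.-tuple RB).

(* On the shell [expR j <= rho < expR j.+1] around [center k] the integrand is at most
   [(neck_width k / rho) ^+ n]. *)
Definition shell_mass k j : R := (neck_width k * expR (- j%:R)) ^+ n.

Definition shell_cube k j : set (n.-tuple RB) :=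
  cube (fun i => center i0 k 0 i) (expR j.+1%:R).

Definition majorant_term k j t : \bar R :=
  ((shell_mass k j)%:E * (\1_(shell_cube k j) t)%:E)%E.

(** As [radius k] is [expR (neck_len k)%:R], the shells with [j < neck_len k] exhaust
    [1 < rho < radius k]. *)
Definition majorant k t : \bar R := (\sum_(j < neck_len k) majorant_term k j t)%E.

Lemma shell_mass_ge0 k j : 0 <= shell_mass k j.
Proof. by rewrite exprn_ge0 // mulr_ge0 ?expR_ge0 // ltW ?neck_width_gt0. Qed.

Lemma majorant_term_ge0 k j t :
  (0 <= majorant_term k j t)%E.
Proof. by rewrite mule_ge0 // lee_fin ?shell_mass_ge0. Qed.

Lemma majorant_ge0 k t : (0 <= majorant k t)%E.
Proof. by apply: sume_ge0 => j _; exact: majorant_term_ge0. Qed.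

Lemma measurable_majorant_term k j : 
  measurable_fun [set: n.-tuple RB] (majorant_term k j).
Proof.
apply: measurable_funeM; apply/measurable_EFinP; apply: measurable_indic.
exact: measurable_cube.
Qed.

(** The mass [rho^(-n)] is scale invariant, so all [neck_len k] shells contribute equally. *)
Lemma integral_majorant k :
  (\int[@lebesgue_measure_n R n]_t majorant k t =
   ((neck_len k)%:R * (2 * expR 1 * neck_width k) ^+ n)%:E)%E.
Proof.
rewrite /majorant ge0_integral_sum //; last 2 first.
- by move=> j; exact: measurable_majorant_term.
- by move=> j t _; exact: majorant_term_ge0.
rewrite (eq_bigr (fun=> ((2 * expR 1 * neck_width k) ^+ n)%:E)).
  by rewrite sumEFin sumr_const card_ord -(mulr_natl (_ ^+ n)).
move=> j _; have mc : measurable (shell_cube k j) by exact: measurable_cube.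
rewrite ge0_integralZl_EFin //; last 2 first.
- by apply/measurable_EFinP; exact: measurable_indic.
- exact: shell_mass_ge0.
have -> : (\int[@lebesgue_measure_n R n]_t (\1_(shell_cube k j) t)%:E =
    ((2 * expR j.+1%:R) ^+ n)%:E)%E.
  by rewrite integral_indic // setIT; exact: lebesgue_measure_cube (expR_ge0 _).
rewrite -EFinM /shell_mass -exprMn; congr (_ ^+ _)%:E.
have -> : expR j.+1%:R = expR j%:R * expR 1 :> R by rewrite -expRD natr1.
rewrite expRN; field.
by rewrite gt_eqF // expR_gt0.
Qed.

(** Here [n >= 3] enters: [neck_len k * neck_width k ^+ 2] is the constant [24], and one more factor
    [neck_width k] makes the series geometric. *)
Lemma integral_majorants : (2 < n)%N ->
  (\int[@lebesgue_measure_n R n]_t (\sum_(k <oo) majorant k t) < +oo)%E.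
Proof.
move=> n2; rewrite integral_nneseries //; last 2 first.
- by move=> k; apply: emeasurable_sum => j; exact: measurable_majorant_term.
- by move=> k t _; exact: majorant_ge0.
pose C : R := 24 * (2 * expR 1) ^+ n.
have C0 : 0 <= C by rewrite mulr_ge0 // exprn_ge0 // mulr_ge0 // expR_ge0.
apply: (@le_lt_trans _ _ (\sum_(k <oo) (C / (2 ^ k.+1)%:R)%:E)%E); last first.
  by apply: le_lt_trans (epsilon_trick0 xpredT C0) _; rewrite ltry.
apply: lee_nneseries => [k _ _|k _].
  by apply: integral_ge0 => t _; exact: majorant_ge0.
rewrite integral_majorant lee_fin exprMn /C.
have le3 : neck_width k ^+ n <= neck_width k ^+ 3 :> R.
  by apply: ler_wiXn2l; rewrite ?neck_width_le1 // ltW ?neck_width_gt0.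
rewrite mulrCA (mulrC 24) -mulrA ler_wpM2l //.
apply: (@le_trans _ _ ((neck_len k)%:R * neck_width k ^+ 3)); first by rewrite ler_wpM2l.
rewrite exprSr mulrA -neck_width2 /neck_width exprVn -natrX.
rewrite le_eqVlt; apply/orP; left; apply/eqP; field.
by rewrite pnatr_eq0 expn_eq0 /= gt_eqF // neck_len_gt0.
Qed.

(** The powers of [expR (F u)] in curvature and volume cancel, leaving [(neck_width k / rho) ^+ n].
    A single term of the double sum, the shell containing [u], already dominates it. *)
Lemma integrand_le t : (0 < n)%N ->
  regular_set i0 (stereo false (row_of_tuple t)) ->
  ((powR (sigma_minus (conformal (factor i0)) (stereo false (row_of_tuple t))) (n%:R / 2) *
    Num.sqrt (\det (gram (conformal (factor i0)) false (row_of_tuple t))))%:E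
   <= \sum_(k <oo) majorant k t)%E.
Proof.
move=> n0 rt; set u := row_of_tuple t.
have [k hk] := near_isolated i0 u.
have hk' : \forall z \near unstereo (stereo false u),
    forall j, j != k -> radius j ^+ 2 < sqdist i0 j z by rewrite stereoK.
have sK := sectional_curvatures_ge rt hk'; rewrite stereoK in sK.
have /andP[s0 s1] := sigma_minus_bound (curv_bound_ge0 i0 k u) sK.
rewrite gram_round_factor /flat_conformal det_scalar.
rewrite (_ : expR _ ^+ n = (expR (F u) ^+ n) ^+ 2); last first.
  by rewrite expRM_natl exprAC.
rewrite sqrtr_sqr ger0_norm ?exprn_ge0 ?expR_ge0 //.
(* [powR 0 0] is [1], so the integrand vanishes where [sigma_minus] does only because the exponent
   is nonzero. *)
have n2 : (n%:R / 2 : R) != 0 by rewrite mulf_neq0 // ?invr_eq0 pnatr_eq0 -?lt0n.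
have sum0 : (0 <= \sum_(k <oo) majorant k t)%E.
  by apply: nneseries_ge0 => l _ _; exact: majorant_ge0.
move: s1; rewrite /curv_bound; case: ifPn => [/andP[q1 qr] s1|_ s1]; last first.
  have -> : sigma_minus (conformal (factor i0)) (stereo false u) = 0 by apply/le_anti/andP.
  by rewrite powR0 // mul0r.
have q0 : 0 < sqdist i0 k u by rewrite (lt_trans _ q1).
pose rho := Num.sqrt (sqdist i0 k u).
have rho2 : rho ^+ 2 = sqdist i0 k u by rewrite sqr_sqrtr // ltW.
have rho0 : 0 < rho by rewrite sqrtr_gt0.
have e0 := expR_gt0 (F u); have w0 := @neck_width_gt0 R k.
have {}s1 : sigma_minus (conformal (factor i0)) (stereo false u) <=
    (neck_width k / (rho * expR (F u))) ^+ 2.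
  by apply: le_trans s1 _; rewrite -rho2 expRM_natl expr_div_n exprMn.
have p1 : powR (sigma_minus (conformal (factor i0)) (stereo false u)) (n%:R / 2) <=
    (neck_width k / (rho * expR (F u))) ^+ n.
  have b0 : 0 <= neck_width k / (rho * expR (F u)) by rewrite divr_ge0 ?mulr_ge0 // ltW.
  apply: le_trans (ge0_ler_powR _ _ _ s1) _; rewrite ?nnegrE ?sqr_ge0 ?divr_ge0 //.
  rewrite -(powR_mulrn 2 b0) -powRrM (_ : 2 * _ = n%:R) ?powR_mulrn //.
  by rewrite mulrC divfK // pnatr_eq0.
(* The integer part of [ln rho] picks the shell [expR j <= rho < expR j.+1]. *)
pose j := Num.truncn (ln rho).
have rho1 : 1 < rho by rewrite -(ltr_pXn2r (ltn0Sn 1)) ?nnegrE ?ler01 ?(ltW rho0) // rho2 expr1n.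
have /andP[j1 j2] := truncn_itv (ln_ge0 (ltW rho1)).
have jk : (j < neck_len k)%N.
  rewrite /j -(ltr_nat R); apply: le_lt_trans j1 _.
  rewrite -ltr_expR lnK ?posrE // -(ltr_pXn2r (ltn0Sn 1)) ?nnegrE ?(ltW rho0) ?expR_ge0 //.
  by rewrite rho2.
apply: (@le_trans _ _ (majorant k t)); last first.
  apply: le_trans (@nneseries_lim_ge R (majorant^~ t) xpredT 0 k.+1 _); last first.
    by move=> l _ _; exact: majorant_ge0.
  rewrite big_nat_recr //= leeDr // sume_ge0 // => l _; exact: majorant_ge0.
rewrite /majorant (bigD1 (Ordinal jk)) //=.
apply: (@le_trans _ _ (majorant_term k j t)); last first.
  by rewrite leeDl // sume_ge0 // => l _; exact: majorant_term_ge0.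
have ct : shell_cube k j t.
  move=> i; have := coord_sqr_le (u - center i0 k) i.
  rewrite -/(sqdist i0 k u) -rho2 => hc.
  have hr : rho <= expR j.+1%:R by rewrite -[leLHS]lnK ?posrE // ler_expR ltW.
  have : `|tnth t i - center i0 k 0 i| <= rho.
    rewrite -(ler_pXn2r (ltn0Sn 1)) ?nnegrE ?normr_ge0 ?(ltW rho0) //.
    rewrite real_normK ?num_real //; apply: le_trans hc.
    by rewrite [in leRHS]mxE [in leRHS]mxE [in leRHS]mxE.
  by rewrite ler_norml => /andP[h1 h2]; apply/andP; split; lra.
rewrite /majorant_term indicE mem_set // mule1 lee_fin.
apply: (@le_trans _ _ ((neck_width k / (rho * expR (F u))) ^+ n * expR (F u) ^+ n)).
  by rewrite ler_wpM2r // exprn_ge0 // ltW.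
rewrite -exprMn /shell_mass (_ : _ * expR (F u) = neck_width k / rho); last first.
  by field; rewrite !gt_eqF.
have hj : expR j%:R <= rho by rewrite -[leRHS]lnK ?posrE // ler_expR.
rewrite lerXn2r ?nnegrE ?divr_ge0 ?mulr_ge0 ?expR_ge0 ?(ltW w0) ?(ltW rho0) //.
by rewrite expRN ler_pM2l // lef_pV2 ?posrE ?expR_gt0.
Qed.

Lemma riem_integral_factor : (2 < n)%N ->
  (riem_integral (conformal (@factor R n i0)) (@regular_set R n i0)
    (fun x => powR (sigma_minus (conformal (@factor R n i0)) x) (n%:R / 2)) < +oo)%E.
Proof.
move=> n2; apply: le_lt_trans (integral_majorants n2).
have m0 t : (0 <= \sum_(k <oo) majorant k t)%E.
  by apply: nneseries_ge0 => k _ _; exact: majorant_ge0.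
apply: ge0_le_integral_restrict => //.
- by move=> t _; rewrite lee_fin mulr_ge0 ?powR_ge0 ?sqrtr_ge0.
- move=> t; rewrite [leRHS]patchT ?in_setT // /patch; case: ifPn => // rt.
  by apply: integrand_le; [exact: leq_trans n2|rewrite inE in rt].
Qed.

End FiniteIntegral.

(** * Completeness *)

Section Continuity.
Context {R : realType}.

Lemma cvg_rowP (T : Type) (G : set_system T) (FG : Filter G) n
    (f : T -> 'rV[R]_n) (l : 'rV[R]_n) :
  (forall j, f y 0 j @[y --> G] --> l 0 j) -> f y @[y --> G] --> l.
Proof.
move=> cf A [P nP sPA]; have : \forall y \near G, forall j, P 0 j (f y 0 j).
  by apply: filter_forall => j; exact: (cf j _ (nP 0 j)).
by apply: filterS => y hy; apply: sPA => i j; rewrite (ord1 i).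
Qed.

Lemma continuous_rowP (T : topologicalType) n (f : T -> 'rV[R]_n) x :
  (forall j, {for x, continuous (fun y => f y 0 j : R)}) -> {for x, continuous f}.
Proof. by move=> cf; apply: cvg_rowP => j; exact: cf. Qed.

Lemma continuous_row_coord (T : topologicalType) n (f : T -> 'rV[R]_n) x j :
  {for x, continuous f} -> {for x, continuous (fun y => f y 0 j : R)}.
Proof.
move=> cf; exact: (continuous_comp cf (@coord_continuous R _ _ 0 j (f x))).
Qed.

Lemma continuous_mulf (T : topologicalType) (f g : T -> R) x :
  {for x, continuous f} -> {for x, continuous g} ->
  {for x, continuous (fun y => f y * g y)}.
Proof. by move=> cf cg; exact: (@continuousM _ _ f g x cf cg). Qed.

Lemma continuous_addf (T : topologicalType) (f g : T -> R) x :
  {for x, continuous f} -> {for x, continuous g} ->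
  {for x, continuous (fun y => f y + g y)}.
Proof. by move=> cf cg; exact: (@continuousD _ _ _ f g x cf cg). Qed.

Lemma continuous_subf (T : topologicalType) (f g : T -> R) x :
  {for x, continuous f} -> {for x, continuous g} ->
  {for x, continuous (fun y => f y - g y)}.
Proof. by move=> cf cg; exact: (@continuousB _ _ _ f g x cf cg). Qed.

Lemma continuous_sumf (T : topologicalType) n (f : 'I_n -> T -> R) x :
  (forall i, {for x, continuous (f i)}) ->
  {for x, continuous (fun y => \sum_(i < n) f i y)}.
Proof.
elim: n f => [|n IH] f cf.
  rewrite (_ : (fun y => _) = cst 0); first exact: cst_continuous.
  by apply/funext => y; rewrite big_ord0.
rewrite (_ : (fun y => _) =
    (fun y => \sum_(i < n) f (widen_ord (leqnSn n) i) y) \+ f ord_max).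
  exact: (continuousD (IH _ (fun i => cf _)) (cf ord_max)).
by apply/funext => y; rewrite big_ord_recr.
Qed.

Lemma continuous_dotv (T : topologicalType) n (f g : T -> 'rV[R]_n) x :
  {for x, continuous f} -> {for x, continuous g} ->
  {for x, continuous (fun y => dotv (f y) (g y))}.
Proof.
move=> cf cg; apply: continuous_sumf => i.
apply: continuous_mulf; exact: continuous_row_coord.
Qed.

End Continuity.

(** * Calibrations, curve lengths and Cauchy sequences *)

Section Completeness.
Context {R : realType} {n : nat} (i0 : 'I_n).
Implicit Types (x y : 'rV[R]_n.+1) (u v w : 'rV[R]_n).
Local Notation center := (@center R n i0).
Local Notation F := (@potential R n i0).
Local Notation regular_set := (@regular_set R n i0).
Local Notation g := (conformal (@factor R n i0)).
Local Notation mu := (@lebesgue_measure R).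

Lemma conformal_factor_unstereo x y : dotv x x = 1 -> dotv x y = 0 -> x 0 0 != 1 ->
  g x y y = expR (2 * F (unstereo x)) * dotv (dunstereo x y) (dunstereo x y).
Proof.
move=> xx xy x1; have s0 := scal_gt0 (unstereo x).
rewrite dotv_dunstereo // -scal_unstereo // /conformal /can /factor /round_factor.
rewrite mulrBr expRB [2 * ln _]mulrC -[in expR (ln _ * _)](mulr_natl 1) mulr1 expRM_natr.
by rewrite lnK ?posrE // mulrAC mulrA.
Qed.

Lemma conformal_factor_stereo u v :
  g (stereo false u) (dstereo u v) (dstereo u v) = expR (2 * F u) * dotv v v.
Proof.
have s0 := scal_gt0 u.
rewrite /conformal /can dotv_dstereo /factor /round_factor stereoK.
rewrite mulrBr expRB [2 * ln _]mulrC -[in expR (ln _ * _)](mulr_natl 1) mulr1 expRM_natr.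
by rewrite lnK ?posrE // mulrA divfK // expf_neq0 // gt_eqF.
Qed.

(* The last clause makes [Phi] 1-Lipschitz for the conformal metric. *)
Definition calibration (Phi : 'rV[R]_n -> R) (grad : 'rV[R]_n -> 'rV[R]_n) : Prop :=
  forall u, (forall k, u != center k) ->
  [/\ forall (c : R -> 'rV[R]_n) r v, c r = u -> is_derive r 1 c v ->
        is_derive r 1 (fun s => Phi (c s)) (dotv (grad u) v),
      {for u, continuous grad} &
      dotv (grad u) (grad u) <= expR (2 * F u)].

Lemma calibrationN Phi grad : calibration Phi grad ->
  calibration (fun u => - Phi u) (fun u => - grad u).
Proof.
move=> cal u uk; have [d c b] := cal u uk; split.
- move=> a r v au da; rewrite dotvNl.
  exact: (@is_deriveN _ _ _ (fun s => Phi (a s)) _ _ _ (d a r v au da)).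
- exact: continuousN.
- by rewrite dotvNl dotvNr opprK.
Qed.

(** As [potential] is nonnegative, the metric dominates the Euclidean metric of the chart. *)
Lemma calibration_coord j : calibration (fun u => u 0 j) (fun=> delta_mx 0 j).
Proof.
move=> u uk; split.
- by move=> c r v _ /is_derive_rowP/(_ j); rewrite dotvC dotv_delta.
- exact: cst_continuous.
- rewrite dotv_delta mxE !eqxx; apply: (@le_trans _ _ (expR 0)); first by rewrite expR0.
  by rewrite ler_expR mulr_ge0 // potential_ge0.
Qed.

(** The gradient of the logarithm of the distance has squared length [1/q], which
    [potential_sqd_ge1] bounds. As this logarithm tends to minus infinity at [center k], the
    puncture is infinitely far away. *)
Lemma calibration_ln k :
  calibration (fun u => 2^-1 * ln (sqdist i0 k u)) (fun u => (sqdist i0 k u)^-1 *: (u - center k)).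
Proof.
move=> u uk; have q0 : 0 < sqdist i0 k u by rewrite sqdist_gt0.
have qn0 : sqdist i0 k u != 0 by rewrite gt_eqF.
split.
- move=> c r v cu dc.
  have dd : is_derive r 1 (fun s => c s - center k) v.
    apply/is_derive_rowP => j; move/is_derive_rowP: dc => /(_ j) dcj.
    have := is_derive_addf dcj (is_derive_cst (- center k 0 j) r 1).
    by rewrite addr0 (_ : (fun _ => _) = fun s => (c s - center k) 0 j) //;
      apply/funext => s; rewrite !mxE.
  have dq := is_derive_dotv dd dd; have q0' := q0; rewrite -cu in q0'.
  have := is_derive_cmul 2^-1 (is_derive_compR dq (is_derive1_ln q0')).
  move=> h; apply: is_derive_eq h _.
  by rewrite cu -/(sqdist i0 k u) dotvZl (dotvC v); field.
- apply: continuous_rowP => j.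
  have c1 : {for u, continuous (fun w => (sqdist i0 k w)^-1)}.
    exact: (cvgV qn0 (@sqdist_continuous R n i0 k u)).
  have c2 : {for u, continuous (fun w : 'rV[R]_n => w 0 j - center k 0 j : R)}.
    by apply: continuousB; [exact: coord_continuous|exact: cst_continuous].
  have := continuousM c1 c2.
  by rewrite (_ : (_ \* _)%R = fun w => ((sqdist i0 k w)^-1 *: (w - center k)) 0 j) //;
    apply/funext => w; rewrite !mxE.
- have h := potential_sqd_ge1 (uk k).
  rewrite dotvZl dotvZr -/(sqdist i0 k u) mulVf // mulr1.
  by rewrite -(ler_pM2r q0) mulVf.
Qed.

Lemma unit_tangent (b : R -> 'rV[R]_n.+1) s t r y : r \in `]s, t[ ->
  {in `]s, t[, forall z, dotv (b z) (b z) = 1} -> is_derive r 1 b y -> dotv (b r) y = 0.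
Proof.
move=> rst b1 db; have [_ d1] := is_derive_dotv db db.
have : 'D_1 (fun z => dotv (b z) (b z)) r = 0.
  rewrite -(derive_cst (1 : R) r 1); apply: near_eq_derive.
  by near=> z; apply: b1; near: z; exact: near_in_itvoo.
rewrite d1 (dotvC y); lra.
Unshelve. all: by end_near. Qed.

(** [T] is the absolute derivative of [Phi] along the curve on the open interval and [0] elsewhere:
    a measurable minorant of the speed. The open interval matters, because at the end points
    [derive1 c] need not be the derivative of the extension [b]. *)
Lemma calibration_piece Phi grad (c b : R -> 'rV[R]_n.+1) s t : calibration Phi grad ->
  s < t -> (forall r, derivable b r 1) -> continuous (derive1 b) ->
  {in `[s, t], c =1 b} -> (forall r, r \in `[s, t] -> regular_set (c r)) ->
  exists T : R -> \bar R, [/\ measurable_fun setT T,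
    forall r, (0 <= T r)%E, forall r, r \notin `]s, t[ -> T r = 0%E,
    forall r, r \in `]s, t[ -> (T r <= (Num.sqrt (g (c r) (derive1 c r) (derive1 c r)))%:E)%E &
    ((Phi (unstereo (c t)) - Phi (unstereo (c s)))%:E <= \int[mu]_r T r)%E].
Proof.
move=> cal st db cdb cb rc.
have rb r : r \in `[s, t] -> regular_set (b r) by move=> rst; rewrite -cb //; exact: rc.
have dbr (r : R) : is_derive r 1 b (derive1 b r).
  by have := db r => /derivableP; rewrite derive1E.
have cbr r : {for r, continuous b}.
  by apply/differentiable_continuous/derivable1_diffP.
pose w r := dunstereo (b r) (derive1 b r).
pose D r := dotv (grad (unstereo (b r))) (w r).
pose H r := Phi (unstereo (b r)).
have dH r : r \in `[s, t] -> is_derive r 1 H (D r).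
  move=> /rb/regP[_ b1 bk]; have [d _ _] := cal _ bk.
  by apply: (d (fun z => unstereo (b z))) => //; exact: is_derive_unstereo.
have cH r : r \in `[s, t] -> {for r, continuous H}.
  by move=> /dH[d _]; apply/differentiable_continuous/derivable1_diffP.
have cD r : r \in `[s, t] -> {for r, continuous D}.
  move=> /rb/regP[_ b1 bk]; have [_ cg _] := cal _ bk.
  have cu : {for r, continuous (fun z => unstereo (b z))}.
    exact: (continuous_comp (cbr r) (continuous_unstereo b1)).
  apply: continuous_dotv; first exact: (continuous_comp cu cg).
  apply: continuous_rowP => j.
  have c0 : {for r, continuous (fun z => (1 - b z 0 0)^-1)}.
    have b1' : 1 - b r 0 0 != 0 by rewrite subr_eq0 eq_sym.
    have cB : {for r, continuous (fun z => 1 - b z 0 0)}.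
      by apply: continuous_subf; [exact: cst_continuous|exact: continuous_row_coord].
    exact: (cvgV b1' cB).
  rewrite (_ : (fun z : R => w z 0 j) = fun z : R =>
     (1 - b z 0 0)^-1 * derive1 b z 0 (lift ord0 j) +
     derive1 b z 0 0 * ((1 - b z 0 0)^-1 * (1 - b z 0 0)^-1) * b z 0 (lift ord0 j)); last first.
    by apply/funext => z; rewrite /w /dunstereo !mxE expr2 invfM.
  have cd i : {for r, continuous (fun z => derive1 b z 0 i)}.
    by apply: continuous_row_coord; exact: cdb.
  apply: continuous_addf; first exact: continuous_mulf.
  apply: continuous_mulf; last exact: continuous_row_coord.
  by apply: continuous_mulf => //; exact: continuous_mulf.
have oc : {subset `]s, t[ <= `[s, t]} by exact: subset_itv_oo_cc.
have mD : measurable_fun `]s, t[ D.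
  apply: open_continuous_measurable_fun; first exact: interval_open.
  by move=> r; rewrite inE /= => rst; apply: cD; exact: oc.
have maD : measurable_fun `]s, t[ (fun r => `|(D r)%:E|%E).
  by apply: measurableT_comp => //; exact/measurable_EFinP.
exists ((fun r => `|(D r)%:E|%E) \_ `]s, t[); split.
- by apply/(measurable_restrictT _ _).1.
- by move=> r; apply: erestrict_ge0.
- by move=> r rst; rewrite /patch; case: ifPn => //; rewrite inE /= (negbTE rst).
- move=> r rst; rewrite /patch mem_set //= lee_fin.
  have nbc : \forall z \near r, b z = c z.
    by near=> z; rewrite cb //; apply: oc; near: z; exact: near_in_itvoo.
  have -> : derive1 c r = derive1 b r.
    by rewrite !derive1E; apply/esym/near_eq_derive.
  have rst' := oc _ rst.
  rewrite cb //; have /regP[b2 b1 bk] := rb _ rst'.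
  have bt : dotv (b r) (derive1 b r) = 0.
    by apply: unit_tangent rst _ (dbr r) => z /oc/rb/regP[].
  rewrite conformal_factor_unstereo // -/(w r).
  have [_ _ gb] := cal _ bk.
  rewrite -sqrtr_sqr; apply: ler_wsqrtr; apply: le_trans (CauchySchwarz_dotv _ _) _.
  by rewrite ler_wpM2r // dotv_ge0.
- rewrite -integral_mkcond.
  rewrite !cb ?in_itv /= ?lexx ?(ltW st) //.
  have FTC : (\int[mu]_(r in `[s, t]) (D r)%:E = (H t)%:E - (H s)%:E)%E.
    apply: continuous_FTC2 => //.
    + by apply: continuous_in_subspaceT => r; rewrite inE; exact: cD.
    + split.
      * by move=> r /oc/dH[].
      * by apply: cvg_at_right_filter; apply: cH; rewrite in_itv /= lexx ltW.
      * by apply: cvg_at_left_filter; apply: cH; rewrite in_itv /= lexx ltW.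
    + by move=> r /oc/dH[_ <-]; rewrite derive1E.
  rewrite -/(H t) -/(H s) EFinB -FTC; apply: le_trans (lee_abs _) _.
  rewrite (integral_itv_bndoo true false); last exact/measurable_EFinP.
  by apply: le_abse_integral => //; exact/measurable_EFinP.
Unshelve. all: by end_near. Qed.

(** The minorants of the pieces are added up. Each new one lives on []t m, t m.+1[], disjoint from
    the earlier support in [[0, t m[], so the sum stays below the speed. *)
Lemma calibration_length Phi grad (c : R -> 'rV[R]_n.+1) : calibration Phi grad ->
  piecewise_C1 c -> (forall r, r \in `[0, 1] -> regular_set (c r)) ->
  ((Phi (unstereo (c 1)) - Phi (unstereo (c 0)))%:E <= curve_length g c)%E.
Proof.
move=> cal [k [t [t0 tk pieces]]] rc.
have tmono i j : (i <= j)%N -> (j <= k)%N -> t i <= t j.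
  elim: j => [|j IH]; first by rewrite leqn0 => /eqP ->.
  rewrite leq_eqVlt => /predU1P[->//|ij jk].
  by apply: le_trans (IH ij (ltnW jk)) _; apply: ltW; exact: (pieces j jk).1.
have itv01 j r : (j < k)%N -> r \in `[t j, t j.+1] -> r \in `[0, 1].
  move=> jk; rewrite !in_itv /= -t0 -tk => /andP[h1 h2]; apply/andP; split.
    by apply: le_trans h1; apply: tmono => //; exact: ltnW.
  by apply: le_trans h2 _; apply: tmono.
have build m : (m <= k)%N -> exists T : R -> \bar R, [/\ measurable_fun setT T,
    forall r, (0 <= T r)%E, forall r, r \notin `[0, t m[ -> T r = 0%E,
    forall r, r \in `[0, 1] -> (T r <= (Num.sqrt (g (c r) (derive1 c r) (derive1 c r)))%:E)%E &
    ((Phi (unstereo (c (t m))) - Phi (unstereo (c 0)))%:E <= \int[mu]_r T r)%E].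
  elim: m => [_|m IH mk].
    exists (cst 0%E); split=> //; first by move=> r _; rewrite lee_fin sqrtr_ge0.
    by rewrite integral0 t0 subrr.
  have [T [mT T0 Tout Tle Tint]] := IH (ltnW mk).
  have [tm [b [db cdb cb]]] := pieces m mk.
  have [T' [mT' T'0 T'out T'le T'int]] := calibration_piece cal tm db cdb cb
    (fun r h => rc r (itv01 m r mk h)).
  exists (fun r => T r + T' r)%E; split.
  - exact: emeasurable_funD.
  - by move=> r; rewrite adde_ge0.
  - move=> r h; have t0m : 0 <= t m by rewrite -t0 tmono // ltnW.
    rewrite Tout ?T'out ?adde0 //; apply: contra h; rewrite !in_itv /= => /andP[h1 h2].
      by rewrite h2 (le_trans t0m (ltW h1)).
    by rewrite h1 (lt_trans h2 tm).
  - move=> r r01; have [h|h] := boolP (r \in `]t m, t m.+1[).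
      rewrite Tout ?add0e; first exact: T'le.
      move: h; rewrite !in_itv /= negb_and -!leNgt => /andP[/ltW -> _].
      by rewrite orbT.
    by rewrite T'out // adde0; exact: Tle.
  - rewrite ge0_integralD //.
    rewrite (_ : Phi _ - _ = (Phi (unstereo (c (t m))) - Phi (unstereo (c 0))) +
      (Phi (unstereo (c (t m.+1))) - Phi (unstereo (c (t m))))); last by ring.
    by rewrite EFinD; exact: leeD.
have [T [mT T0 Tout Tle]] := build k (leqnn k); rewrite tk => Tint.
apply: le_trans Tint _; apply: ge0_le_integral_restrict => //.
move=> r; rewrite [leLHS]patchT ?in_setT // /patch; case: ifPn.
    by rewrite inE; exact: Tle.
  rewrite notin_setE /= => r01; rewrite Tout //; apply/negP => h; apply: r01.
  by move: h; rewrite !in_itv /= tk => /andP[-> /ltW].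
Qed.

Lemma calibration_dist Phi grad u w : calibration Phi grad ->
  (`|Phi w - Phi u|%:E <= riem_dist g regular_set (stereo false u) (stereo false w))%E.
Proof.
move=> cal; apply: le_ereal_inf_tmp => _ [c [pc c0 c1 rc ->]].
have h1 := calibration_length cal pc rc.
have h2 := calibration_length (calibrationN cal) pc rc.
rewrite c0 c1 !stereoK in h1; rewrite c0 c1 !stereoK opprK addrC in h2.
by case: (ler0P (Phi w - Phi u)) => _; rewrite // opprB.
Qed.

(** The straight segment in the chart is a competitor, and along it the metric is at most [C ^+ 2]
    times the Euclidean one. *)
Lemma segment_dist (B : set 'rV[R]_n) (C : R) u w : 0 <= C ->
  (forall r, r \in `[0, 1] -> B (u + r *: (w - u))) ->
  (forall z, B z -> (forall k, z != center k) /\ expR (F z) <= C) ->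
  (riem_dist g regular_set (stereo false u) (stereo false w)
    <= (C * Num.sqrt (dotv (w - u) (w - u)))%:E)%E.
Proof.
move=> C0 + hB; have [v vE] : exists v, v = w - u by eexists.
rewrite -vE => seg.
pose gam (r : R) := u + r *: v.
have dgam (r : R) : is_derive r 1 gam v.
  apply/is_derive_rowP => j.
  rewrite (_ : (fun _ => _) = fun z => u 0 j + z * v 0 j); last first.
    by apply/funext => z; rewrite !mxE.
  apply: is_derive_eq (is_derive_addf (is_derive_cst (u 0 j) r 1)
    (is_derive_mulf (is_derive_id r 1) (is_derive_cst (v 0 j) r 1))) _.
  by rewrite mulr0 add0r mulr1 add0r.
pose c (r : R) := stereo false (gam r).
have dc (r : R) : is_derive r 1 c (dstereo (gam r) v) by exact: is_derive_stereo.
have dcE : derive1 c = fun r => dstereo (gam r) v.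
  by apply/funext => r; rewrite derive1E; have [_ ->] := dc r.
apply: ge_ereal_inf; exists (curve_length g c).
  exists c; split=> //.
  - exists 1%N, (fun i => i%:R); split=> // i; rewrite ltnS leqn0 => /eqP ->.
    split; first by rewrite ltr01.
    exists c; split; [by move=> r; have [] := dc r| |by []].
    rewrite dcE => r; have cgam : {for r, continuous gam}.
      by apply/differentiable_continuous/derivable1_diffP; have [] := dgam r.
    have cc : {for r, continuous c}.
      by apply/differentiable_continuous/derivable1_diffP; have [] := dc r.
    have cs : {for r, continuous (fun z => scal (gam z))}.
      rewrite (_ : (fun z => _) = fun z => 1 - c z 0 0); last first.
        by apply/funext => z; rewrite /c stereo_hd opprB addrC subrK.
      by apply: continuous_subf; [exact: cst_continuous|exact: continuous_row_coord].
    have cd : {for r, continuous (fun z => scal (gam z) * scal (gam z) * dotv (gam z) v)}.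
      have cdv : {for r, continuous (fun z => dotv (gam z) v)}.
        by apply: continuous_dotv; [exact: cgam|exact: (@cst_continuous _ _ v r)].
      by apply: continuous_mulf; [exact: continuous_mulf|exact: cdv].
    apply: continuous_rowP => i1; have [j ->|->] := unliftP ord0 i1.
      rewrite (_ : (fun z => _) = fun z => scal (gam z) * v 0 j -
          scal (gam z) * scal (gam z) * dotv (gam z) v * gam z 0 j); last first.
        by apply/funext => z; rewrite -tlE dstereo_tl !mxE expr2.
      apply: continuous_subf; first by apply: continuous_mulf => //; exact: cst_continuous.
      by apply: continuous_mulf => //; exact: continuous_row_coord.
    rewrite (_ : (fun z => _) = fun z => scal (gam z) * scal (gam z) * dotv (gam z) v) //.
    by apply/funext => z; rewrite dstereo_hd expr2.
  - by rewrite /c /gam scale0r addr0.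
  - by rewrite /c /gam scale1r vE addrC subrK.
  - by move=> r r01; apply/reg_stereo; exact: (hB _ (seg r r01)).1.
rewrite /curve_length.
apply: (@le_trans _ _ (\int[mu]_(r in `[0%R, 1%R]) (C * Num.sqrt (dotv v v))%:E)%E).
  apply: ge0_le_integral_restrict.
  - by move=> r _; rewrite lee_fin sqrtr_ge0.
  - by move=> r _; rewrite lee_fin mulr_ge0 ?sqrtr_ge0.
  - move=> r; rewrite /patch; case: ifPn => //; rewrite inE => r01.
    rewrite lee_fin dcE conformal_factor_stereo expRM_natl sqrtrM ?sqr_ge0 //.
    rewrite sqrtr_sqr ger0_norm ?expR_ge0 // ler_wpM2r ?sqrtr_ge0 //.
    exact: (hB _ (seg r r01)).2.
rewrite integral_cst //= lebesgue_measure_itv /= lte_fin ltr01.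
by rewrite -EFinB subr0 mule1.
Qed.

(** The coordinate calibrations give a limit [l] in the chart, and the logarithmic ones exclude that
    [l] is a center. Near [l] the conformal factor is bounded, so [segment_dist] turns convergence
    of coordinates into convergence in [riem_dist]. *)
Lemma complete_factor : complete_metric g regular_set.
Proof.
move=> a ra Ca; pose U k := unstereo (a k).
have aE k : a k = stereo false (U k).
  by rewrite unstereoK //; have /regP[] := ra k.
have Uk k j : U k != center j by have /regP[_ _] := ra k; apply.
have cau Phi grad : calibration Phi grad -> forall e : R, 0 < e ->
    exists N, forall p q, (N <= p)%N -> (N <= q)%N -> `|Phi (U q) - Phi (U p)| < e.
  move=> cal e e0; have [N hN] := Ca e e0; exists N => p q Np Nq.
  rewrite -lte_fin; apply: le_lt_trans (hN p q Np Nq).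
  by have := calibration_dist (U p) (U q) cal; rewrite -!aE.
have cvg_coord j : cvgn (fun k => U k 0 j : R).
  apply/cauchy_cvgP/cauchy_ballP => e e0.
  have [N hN] := cau _ _ (calibration_coord j) e e0.
  pose A : set R := [set U k 0 j | k in [set k | (N <= k)%N]].
  exists (A, A) => /=; first by split; exists N => // k Nk; exists k.
  by move=> [_ _] [/= [p Np <-] [q Nq <-]]; exact: hN.
pose l : 'rV[R]_n := \row_j limn (fun k => U k 0 j).
have Ul : U k @[k --> \oo] --> l.
  by apply: cvg_rowP => j; rewrite mxE; exact: cvg_coord.
have sqdist_lim j : sqdist i0 j (U k) @[k --> \oo] --> sqdist i0 j l.
  by apply: continuous_cvg; [exact: sqdist_continuous|exact: Ul].
have lk j : l != center j.
  have [N hN] := cau _ _ (calibration_ln j) 1 ltr01.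
  have qN : 0 < sqdist i0 j (U N) by rewrite sqdist_gt0.
  (* The calibration is half the logarithm of [sqdist], so a variation below [1] means that [ln] of
     [sqdist] drops by less than [2]. *)
  rewrite -sqdist_gt0; apply: (@lt_le_trans _ _ (expR (- 2) * sqdist i0 j (U N))).
    by rewrite mulr_gt0 ?expR_gt0.
  rewrite -(cvg_lim (@norm_hausdorff _ _) (sqdist_lim j)).
  apply: limr_ge; first by apply/cvg_ex; exists (sqdist i0 j l).
  near=> p.
  have Np : (N <= p)%N by near: p; exists N.
  have qp : 0 < sqdist i0 j (U p) by rewrite sqdist_gt0.
  have := hN p N Np (leqnn N); rewrite -mulrBr ltr_norml => /andP[_ h].
  rewrite -[X in _ * X]lnK ?posrE // -expRD -[leRHS]lnK ?posrE // ler_expR; lra.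
exists (stereo false l); first exact/reg_stereo.
have cF : {for l, continuous F} by exact: (Ck_on_continuous (Ck_on_potential i0 0)).
have nl : \forall z \near l, (forall k, z != center k) /\ expR (F z) <= expR (F l + 1).
  have no : nbhs l [set u | forall k, u != center k].
    by apply: open_nbhs_nbhs; split; [exact: open_reg|exact: lk].
  apply: filterI no _; have : \forall z \near l, F z < F l + 1.
    by apply: (cvgr_lt _ cF); rewrite ltrDl.
  by apply: filterS => z h; rewrite ler_expR ltW.
have [/= e e0 he] := (nbhs_ballP _ _).1 nl.
apply: (@squeeze_cvge _ _ _ _ (cst 0%E) _
  (fun k => (expR (F l + 1) * Num.sqrt (dotv (l - U k) (l - U k)))%:E)).
- near=> k; apply/andP; split.
    apply: le_ereal_inf_tmp => _ [c [_ _ _ _ ->]].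
    by apply: integral_ge0 => r _; rewrite lee_fin sqrtr_ge0.
  (* Balls here are sup norm balls, so the segment from [U k] to [l] is checked to stay inside
     coordinate by coordinate. *)
  rewrite aE; apply: (@segment_dist (ball l e)); [exact: expR_ge0| |exact: he].
  move=> r r01; split=> // i j; rewrite (ord1 i).
  have kb : ball l e (U k).
    by near: k; apply: Ul; exact: nbhsx_ballx.
  have := kb.2 0 j; rewrite /ball /= !mxE => h.
  rewrite (_ : _ - _ = (1 - r) * (l 0 j - U k 0 j)); last by rewrite !mxE; ring.
  move: r01; rewrite in_itv /= => /andP[r0 r1].
  rewrite normrM ger0_norm ?subr_ge0 //; apply: le_lt_trans h; rewrite !mxE.
  by rewrite ler_piMl // gerBl.
- exact: cvg_cst.
- apply: cvg_EFin; first by near=> k.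
  have d0 : dotv (U k - l) (U k - l) @[k --> \oo] --> (0 : R).
    rewrite -(dotv0l (0 : 'rV[R]_n)) -(subrr l).
    apply: (@continuous_cvg _ _ _ _ _ U (fun z => dotv (z - l) (z - l))); last exact: Ul.
    exact: (Ck_on_continuous (Ck_on_sqnorm 0 l openT)).
  have s0 : Num.sqrt (dotv (U k - l) (U k - l)) @[k --> \oo] --> Num.sqrt (0 : R).
    by apply: continuous_cvg; [exact: sqrt_continuous|exact: d0].
  suff : expR (F l + 1) * Num.sqrt (dotv (l - U k) (l - U k)) @[k --> \oo] --> (0 : R) by [].
  rewrite (_ : (fun k => _ * _) = fun k => expR (F l + 1) * Num.sqrt (dotv (U k - l) (U k - l))).
    rewrite -(mulr0 (expR (F l + 1))) -[X in _ * X]sqrtr0.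
    by apply: cvgM; [exact: cvg_cst|exact: s0].
  by apply/funext => k; rewrite -(opprB (U k)) dotvNl dotvNr opprK.
Unshelve. all: by end_near. Qed.

End Completeness.

Theorem theoremE (R : realType) (n : nat) (hn : (3 <= n)%N) :
  exists (Sigma : set 'rV[R]_n.+1) (f : 'rV[R]_n.+1 -> R),
    let M := sphere R n `\` Sigma in
    let g := conformal f in
    [/\ Sigma `<=` sphere R n, closed Sigma, infinite_set Sigma & M !=set0] /\
    [/\ smooth_fun M f,
        complete_metric g M,
        sec_bounded_below g M &
        (riem_integral g M
           (fun x => powR (sigma_minus g x) (n%:R / 2)) < +oo)%E].
Proof.
have i0 : 'I_n by apply: (@Ordinal n 0); exact: leq_trans hn.
exists (singular_set i0), (factor i0) => /=; split; split.
- by move=> x [].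
- exact: closed_sing.
- exact: infinite_sing.
- exact: reg_neq0.
- exact: smooth_factor.
- exact: complete_factor.
- exact: sec_bounded_below_factor.
- exact: riem_integral_factor.
Qed.
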